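(* Let $(Z_t : t\ge 0)\subset\Omega$ be a reversible, time-homogeneous Markov process with initial value $Z_0$ and stationary probability measure $\mu$ on a Polish space $\Omega$. Let $\alpha>0$, and suppose that the process satisfies the trace Poincaré inequality with constant $\alpha$ (equivalently, the scalar Poincaré inequality with the same constant $\alpha$). Let $\boldsymbol f:\Omega\to\mathbb H_d$ be a suitable matrix-valued function, and define the variance proxy $$v_{\boldsymbol f} := \big\| \, \|\boldsymbol\Gamma(\boldsymbol f)(z)\| \, \big\|_{L_\infty(\mu)}.$$ Then: (1) For all $\lambda>0$, $$\mathbb P_{\mu}\big\{ \|\boldsymbol f-\mathbb E_\mu \boldsymbol f\| \ge \sqrt{\alpha v_{\boldsymbol f}}\cdot\lambda\big\} \le 6d\cdot \mathrm e^{-\lambda}.$$ (2) In particular, $$\mathbb E_\mu\|\boldsymbol f-\mathbb E_\mu\boldsymbol f\| \le \log(6\mathrm e d)\cdot\sqrt{\alpha v_{\boldsymbol f}}.$$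
   Context: Notation. $\mathbb H_d$ is the real linear space of $d\times d$ self-adjoint complex matrices, $\mathbb H_d^+$ its cone of positive-semidefinite matrices, $\|\cdot\|$ the $\ell_2$ operator norm, $\operatorname{tr}$ the ordinary trace. A scalar function $\varphi:\mathbb R\to\mathbb R$ acts on $\mathbb H_d$ through the spectral resolution; such functions bind before trace and expectation. $\mathbb P_\mu,\mathbb E_\mu$ are probability and expectation with respect to $z\sim\mu$. Carré du champ and Dirichlet form: $$\boldsymbol\Gamma(\boldsymbol f)(z):=\lim_{t\downarrow0}\tfrac1{2t}\,\mathbb E\big[(\boldsymbol f(Z_t)-\boldsymbol f(Z_0))^2\,\big|\,Z_0=z\big]\in\mathbb H_d^+,$$ $$\boldsymbol{\mathcal E}(\boldsymbol f):=\lim_{t\downarrow0}\tfrac1{2t}\,\mathbb E_{Z\sim\mu}\big[(\boldsymbol f(Z_t)-\boldsymbol f(Z_0))^2\,\big|\,Z_0=Z\big]\in\mathbb H_d^+,$$ so that $\boldsymbol{\mathcal E}(\boldsymbol f)=\mathbb E_\mu\boldsymbol\Gamma(\boldsymbol f)$ (in the second formula the process is started from $\mu$). Matrix variance: $\mathbf{Var}_\mu[\boldsymbol f]:=\mathbb E_\mu[(\boldsymbol f-\mathbb E_\mu\boldsymbol f)^2]$. Trace Poincaré inequality with constant $\alpha$: $\operatorname{tr}\mathbf{Var}_\mu[\boldsymbol f]\le\alpha\cdot\operatorname{tr}\boldsymbol{\mathcal E}(\boldsymbol f)$ for all $d\in\mathbb N$ and all regular $\boldsymbol f:\Omega\to\mathbb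 H_d$. The scalar Poincaré inequality is the case $d=1$ ($\mathbb H_1=\mathbb R$). Regularity convention. Throughout, functions are restricted to a ''nice'' class for which the limit defining $\boldsymbol\Gamma$ exists pointwise and in $L_1(\mu)$ and for which manipulations of expectations, limits and derivatives are justified. Concretely: $\boldsymbol f:\Omega\to\mathbb H_d$ is regular if it is measurable, $\mathbb E_\mu\|\boldsymbol f\|^2<\infty$, the limit defining $\boldsymbol\Gamma(\boldsymbol f)$ exists pointwise and in $L_1(\mu)$, and the same holds for the real and imaginary parts of the scalar functions $\langle \boldsymbol u,\boldsymbol f\boldsymbol v\rangle$, $\boldsymbol u,\boldsymbol v\in\mathbb C^d$. For a function on $\Omega^2$, the coordinate-wise carré du champ is the carré du champ computed in one coordinate with the other coordinate held fixed; such a function is regular if it is square integrable for $\mu\otimes\mu$, is regular in each coordinate when the other coordinate is fixed, and its two coordinate-wise carré du champ limits also converge in $L_1(\mu\otimes\mu)$. ''Suitable'' means that $\boldsymbol f$ is regular and that the functions derived from it, namely $\boldsymbol f-\mathbb E_\mu\boldsymbol f$, the function $\boldsymbol g(z,z')=\boldsymbol f(z)-\boldsymbol f(z')$ and $\sinh(c\,\boldsymbol g)$ for $c>0$, are regular as well, and that the limits $t\downarrow 0$ in the coordinate-wise carré du champ of $\boldsymbol g$ may be exchanged with the $\mu\otimes\mu$-expectation after multiplication by $\cosh^2(c\,\boldsymbol g)$ under the trace.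
   Formalization: Part (1) is stated only for v_f > 0: if f is constant, then v_f = 0, the event has probability 1 and the bound fails for λ > log(6d). Part (2) keeps v_f = 0. The Poincaré hypothesis is the trace form; its parenthetical equivalence with the scalar form is not proved. *)

(* Defs.v *)
From mathcomp Require Import all_boot all_order all_algebra.
From mathcomp Require Import sesquilinear spectral.
From mathcomp Require Import complex.
From mathcomp Require Import all_classical all_reals all_analysis.

Set Implicit Arguments.
Unset Strict Implicit.
Unset Printing Implicit Defensive.

Import Order.TTheory GRing.Theory Num.Theory Num.Def.
Import numFieldNormedType.Exports.
Local Open Scope classical_set_scope.
Local Open Scope ring_scope.
Local Open Scope sesquilinear_scope.
Local Open Scope complex_scope.

Definition separable (T : topologicalType) : Prop :=
  exists2 D : set T, countable D & dense D.

Definition completely_metrizable (R : realType) (T : topologicalType) : Prop :=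
  exists dist : T -> T -> R,
    [/\ [/\ forall x y, 0 <= dist x y,
            forall x y, dist x y = 0 <-> x = y,
            forall x y, dist x y = dist y x &
            forall x y z, dist x z <= dist x y + dist y z],
        forall A : set T, open A <->
          (forall x, A x -> exists2 e, 0 < e & [set y | dist x y < e] `<=` A) &
        forall u : nat -> T,
          (forall e, 0 < e -> exists N : nat, forall m n : nat,
             (N <= m)%N -> (N <= n)%N -> dist (u m) (u n) < e) ->
          exists l : T, u @ \oo --> l].

Definition polish (R : realType) (T : topologicalType) : Prop :=
  separable T /\ completely_metrizable R T.

Notation Borel T := (g_sigma_algebraType (@open T)).

Definition sinh {R : realType} (x : R) : R := (expR x - expR (- x)) / 2.
Definition cosh {R : realType} (x : R) : R := (expR x + expR (- x)) / 2.

Section matrices.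
Context {R : realType}.

Definition l2norm n (v : 'cV[R[i]]_n) : R :=
  Num.sqrt (\sum_(i < n)
    (complex.Re (v i 0) ^+ 2 + complex.Im (v i 0) ^+ 2)).

Definition opnorm n (A : 'M[R[i]]_n) : R :=
  sup [set l2norm (A *m v) | v in [set v : 'cV[R[i]]_n | l2norm v <= 1]].

(* The standard functional calculus.  For [A] self-adjoint, [spectral_diag A]
   is real and [A] equals
   [invmx (spectralmx A) *m diag_mx (spectral_diag A) *m spectralmx A]. *)
Definition mxfun (phi : R -> R) n (A : 'M[R[i]]_n) : 'M[R[i]]_n :=
  invmx (spectralmx A)
    *m diag_mx (map_mx (fun x => (phi (complex.Re x))%:C) (spectral_diag A))
    *m spectralmx A.

Definition inner n (u v : 'cV[R[i]]_n) : R[i] := (u ^t* *m v) 0 0.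

Definition selfadjoint {T : Type} n (f : T -> 'M[R[i]]_n) : Prop :=
  forall x, f x \is hermsymmx.

Definition mx1 (x : R) : 'M[R[i]]_1 := (x%:C)%:M.

Definition mx_is_cvg0 n (F : R -> 'M[R[i]]_n) : Prop := forall i j,
  cvg (complex.Re (F t i j) @[t --> 0^'+]) /\
  cvg (complex.Im (F t i j) @[t --> 0^'+]).

Definition mx_lim0 n (F : R -> 'M[R[i]]_n) : 'M[R[i]]_n :=
  \matrix_(i, j) (lim (complex.Re (F t i j) @[t --> 0^'+])
                  +i* lim (complex.Im (F t i j) @[t --> 0^'+])).

End matrices.

Section expectation.
Context d (T : measurableType d) {R : realType}.
Variable m : {measure set T -> \bar R}.

Definition mx_measurable n (F : T -> 'M[R[i]]_n) : Prop := forall i j,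
  measurable_fun setT (fun x => complex.Re (F x i j)) /\
  measurable_fun setT (fun x => complex.Im (F x i j)).

Definition mexp n (F : T -> 'M[R[i]]_n) : 'M[R[i]]_n :=
  \matrix_(i, j) ((\int[m]_x complex.Re (F x i j))
                  +i* (\int[m]_x complex.Im (F x i j))).

Definition mx_sqintegrable n (F : T -> 'M[R[i]]_n) : Prop :=
  mx_measurable F /\ (\int[m]_x (opnorm (F x) ^+ 2)%:E < +oo)%E.

Definition mvar n (F : T -> 'M[R[i]]_n) : 'M[R[i]]_n :=
  mexp (fun x => (F x - mexp F) ^+ 2).

End expectation.

Section markov.
Context d dW (T : measurableType d) (W : measurableType dW) {R : realType}.
(* [Z t] is the state at time [t], for [t >= 0]; [P z] is the law of the process
   conditioned on [Z 0 = z], so [E( . | Z 0 = z)] is the [P z]-expectation. *)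
Variables (Z : R -> W -> T) (P : R.-pker T ~> W).

Definition past (s : R) : set (set W) :=
  <<s \bigcup_(u in [set u : R | 0 <= u <= s])
        preimage_set_system setT (Z u) measurable >>.

Record markov_process : Prop := {
  markov_measurable : forall t : R, 0 <= t -> measurable_fun setT (Z t) ;
  markov_init : forall z (A : set T), measurable A ->
    P z (Z 0 @^-1` A) = \d_z A ;
  markov_property : forall z (s t : R), 0 <= s -> 0 <= t ->
    forall (F : set W) (A : set T), past s F -> measurable A ->
    P z (F `&` Z (s + t) @^-1` A) =
      (\int[P z]_(w in F) P (Z s w) (Z t @^-1` A))%E }.

Variable mu : probability T R.

Definition stationary : Prop := forall t : R, 0 <= t ->
  forall A : set T, measurable A ->
  (\int[mu]_z P z (Z t @^-1` A))%E = mu A.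

(* When Z 0 has law mu, the pairs (Z 0, Z t) and (Z t, Z 0) have the same law. *)
Definition reversible : Prop := forall t : R, 0 <= t ->
  forall A B : set T, measurable A -> measurable B ->
  (\int[mu]_(z in A) P z (Z t @^-1` B) =
   \int[mu]_(z in B) P z (Z t @^-1` A))%E.

(* [cdc] is the carre du champ operator, the limit of [cdc_approx]; in
   [dirichlet] the initial state is averaged over mu before taking the limit. *)
Definition cond_sq_incr n (f : T -> 'M[R[i]]_n) (t : R) (z : T) :=
  mexp (P z) (fun w => (f (Z t w) - f (Z 0 w)) ^+ 2).

Definition cdc_approx n (f : T -> 'M[R[i]]_n) (t : R) (z : T) : 'M[R[i]]_n :=
  ((2 * t)^-1)%:C *: cond_sq_incr f t z.

Definition cdc n (f : T -> 'M[R[i]]_n) (z : T) : 'M[R[i]]_n :=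
  mx_lim0 (fun t => cdc_approx f t z).

Definition dirichlet n (f : T -> 'M[R[i]]_n) : 'M[R[i]]_n :=
  mx_lim0 (fun t => ((2 * t)^-1)%:C *: mexp mu (cond_sq_incr f t)).

(* Pointwise existence of the limit includes that the conditional second moment
   is finite for small t; otherwise [mexp] is not an expectation. *)
Definition cdc_pointwise n (f : T -> 'M[R[i]]_n) : Prop := forall z,
  (\forall t \near 0^'+,
     mx_sqintegrable (P z) (fun w => f (Z t w) - f (Z 0 w))) /\
  mx_is_cvg0 (fun t => cdc_approx f t z).

Definition cdc_L1 n (f : T -> 'M[R[i]]_n) : Prop :=
  (\int[mu]_z (opnorm (cdc_approx f t z - cdc f z))%:E)%E
    @[t --> 0^'+] --> 0%E.

Definition cdc_exists n (f : T -> 'M[R[i]]_n) : Prop :=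
  cdc_pointwise f /\ cdc_L1 f.

Definition regular n (f : T -> 'M[R[i]]_n) : Prop :=
  [/\ selfadjoint f, mx_sqintegrable mu f, cdc_exists f &
      forall u v : 'cV[R[i]]_n,
        cdc_exists (fun z => mx1 (complex.Re (inner u (f z *m v)))) /\
        cdc_exists (fun z => mx1 (complex.Im (inner u (f z *m v))))].

Definition trace_poincare (alpha : R) : Prop :=
  forall n (f : T -> 'M[R[i]]_n), regular f ->
    \tr (mvar mu f) <= alpha%:C * \tr (dirichlet f).

Definition cdc1_approx n (h : T * T -> 'M[R[i]]_n) (t : R) (p : T * T) :=
  cdc_approx (fun z => h (z, p.2)) t p.1.
Definition cdc2_approx n (h : T * T -> 'M[R[i]]_n) (t : R) (p : T * T) :=
  cdc_approx (fun z => h (p.1, z)) t p.2.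
Definition cdc1 n (h : T * T -> 'M[R[i]]_n) (p : T * T) :=
  cdc (fun z => h (z, p.2)) p.1.
Definition cdc2 n (h : T * T -> 'M[R[i]]_n) (p : T * T) :=
  cdc (fun z => h (p.1, z)) p.2.

Definition regular2 n (h : T * T -> 'M[R[i]]_n) : Prop :=
  [/\ mx_sqintegrable (mu \x mu)%E h,
      forall z', regular (fun z => h (z, z')),
      forall z, regular (fun z' => h (z, z')),
      (\int[mu \x mu]_p (opnorm (cdc1_approx h t p - cdc1 h p))%:E)%E
        @[t --> 0^'+] --> 0%E &
      (\int[mu \x mu]_p (opnorm (cdc2_approx h t p - cdc2 h p))%:E)%E
        @[t --> 0^'+] --> 0%E].

(* The trace of [A *m cosh (c g) ^ 2], for [A] positive semidefinite, is real
   and nonnegative; its integral is therefore taken in the extended reals. *)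
Definition tr_cosh2 n (c : R) (g : T * T -> 'M[R[i]]_n)
    (A : T * T -> 'M[R[i]]_n) (p : T * T) : R :=
  complex.Re (\tr (A p *m mxfun cosh (c%:C *: g p) ^+ 2)).

Definition cdc_exchange n (c : R) (g : T * T -> 'M[R[i]]_n) : Prop :=
  ((\int[mu \x mu]_p (tr_cosh2 c g (cdc1_approx g t) p)%:E)%E
     @[t --> 0^'+] --> (\int[mu \x mu]_p (tr_cosh2 c g (cdc1 g) p)%:E)%E) /\
  ((\int[mu \x mu]_p (tr_cosh2 c g (cdc2_approx g t) p)%:E)%E
     @[t --> 0^'+] --> (\int[mu \x mu]_p (tr_cosh2 c g (cdc2 g) p)%:E)%E).

Definition suitable n (f : T -> 'M[R[i]]_n) : Prop :=
  let g := fun p : T * T => f p.1 - f p.2 in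
  [/\ regular f, regular (fun z => f z - mexp mu f), regular2 g &
      forall c : R, 0 < c ->
        regular2 (fun p => mxfun sinh (c%:C *: g p)) /\ cdc_exchange c g].

Definition variance_proxy n (f : T -> 'M[R[i]]_n) : \bar R :=
  Lnorm mu +oo%E (fun z => (opnorm (cdc f z))%:E).

End markov.

(* Main.v *)
From HB Require Import structures.
Require Import Defs.
From mathcomp Require Import all_boot all_order all_algebra.
From mathcomp Require Import sesquilinear spectral complex.
From mathcomp Require Import all_classical all_reals all_analysis.
From mathcomp Require Import measurable_realfun ess_sup_inf.
From mathcomp Require Import ring lra.

(** Write [f0 = f - E f], [g (z, z') = f z - f z'] and [h = sinh (c g)], and let
    [w] be a positive upper bound of the variance proxy.  Everything follows from
    the bound [E (tr cosh (2 c g)) <= 3 d] for [c = 1 / (2 sqrt (alpha w))].  Since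
    [E f0 = 0], Jensen's inequality in [z'], in the form of the tangent
    inequality [cosh_trace_tangent], passes it to
    [cosh (2 c ||f0 z||) <= tr cosh (2 c f0 z)]; the tail bound is then Markov's
    inequality ([deviation_tail]), and the mean bound comes from the tangent line
    of the exponential ([deviation_mean]).

    As [cosh (2 x) = 1 + 2 sinh (x) ^ 2], the bound to prove is
    [E ||h||_HS^2 <= d], where [||.||_HS] is the Hilbert-Schmidt norm.  The
    function [h] is antisymmetric.  For an antisymmetric
    square integrable [k] the Efron-Stein inequality takes the one-sided form
    [E k^2 <= 2 E_(z') Var_z k (z, z')] ([antisym_variance]): the sum over both
    coordinates is twice the contribution of the first.  The trace Poincare
    inequality bounds the variance of [h (., z')] by [alpha] times its Dirichlet
    form, which is the limit for small [t] of the energies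
    [E ||h (Z_t, z') - h (Z_0, z')||_HS^2 / (2 t)] of the process started from [mu]
    ([energy_cvg]).  Fatou's lemma lets the limit come out of the integral in
    [z'].

    At a fixed time the chain rule is a statement about two Hermitian matrices
    ([sinh_trace_chain]),
    [||sinh A - sinh B||_HS^2 <= tr ((A - B)^2 (cosh A ^2 + cosh B ^2)) / 2].
    Expanded in the eigenbases [(u_i)] of [A] and [(v_j)] of [B], both sides are
    combinations of scalar expressions in the eigenvalues with the same weights
    [|<u_i, v_j>|^2], so that it reduces to real numbers; the tangent inequality
    is proved in the same way.  Reversibility makes the two terms on the right
    equal in mean, which leaves [tr ((c g_t)^2 cosh (c g)^2)] with the weight taken
    at time 0 ([energy_chain_rule]).  Divided by [2 t], its mean converges by the
    exchange hypothesis to [c^2 E (tr (Gamma (f) cosh (c g)^2))], which is at most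
    [c^2 w E (tr cosh (c g)^2) = c^2 w (d + E ||h||_HS^2)].  Altogether
    [E ||h||_HS^2 <= 2 alpha c^2 w (d + E ||h||_HS^2)] ([sinh_moment_le]), where
    [2 alpha c^2 w = 1 / 2] and the moment is finite, whence the claim.

    For the mean, a variance proxy equal to 0 is reached by letting [w] tend to 0;
    an infinite one makes both bounds trivial. *)

Set Implicit Arguments.
Unset Strict Implicit.
Unset Printing Implicit Defensive.

Import Order.TTheory GRing.Theory Num.Theory.
Import numFieldNormedType.Exports.
Local Open Scope classical_set_scope.
Local Open Scope ring_scope.

(** * Integrals, variances and antisymmetric kernels *)

Section integral_tools.
Context d (T : measurableType d) (R : realType).
Variable m : {measure set T -> \bar R}.

(** The integral of a nonnegative function is a supremum over the simple
    functions below it, so that it is monotone with no measurability. *)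
Lemma ge0_le_integralT (f g : T -> \bar R) : (forall x, 0 <= f x)%E ->
  (forall x, f x <= g x)%E -> (\int[m]_x f x <= \int[m]_x g x)%E.
Proof.
move=> f0 fg; have g0 x : (0 <= g x)%E := le_trans (f0 x) (fg x).
rewrite !ge0_integralTE//; apply: le_ereal_sup => _ [h /= hf <-].
by exists h => //= x; exact: le_trans (hf x) (fg x).
Qed.

Lemma integrable_of_sq (f : T -> R) : m setT = 1%E -> measurable_fun setT f ->
  (\int[m]_x (f x ^+ 2)%:E < +oo)%E -> m.-integrable setT (EFin \o f).
Proof.
move=> m1 mf f2; apply/integrableP; split; first exact/measurable_EFinP.
apply: (@le_lt_trans _ _ (\int[m]_x (1 + (f x ^+ 2)%:E))%E).
  apply: ge0_le_integralT => x //=.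
  rewrite -EFinD lee_fin -[f x ^+ 2]real_normK ?num_real//.
  by have := normr_ge0 (f x); have := sqr_ge0 (`|f x| - 1); nra.
rewrite ge0_integralD//; last 2 first.
- by move=> x _; rewrite lee_fin sqr_ge0.
- exact/measurable_EFinP/measurable_funX.
by rewrite integral_cst// mul1e m1 lte_add_pinfty// ltry.
Qed.

Lemma integrable_mul_sq (f g : T -> R) :
  measurable_fun setT f -> measurable_fun setT g ->
  (\int[m]_x (f x ^+ 2)%:E < +oo)%E -> (\int[m]_x (g x ^+ 2)%:E < +oo)%E ->
  m.-integrable setT (fun x => (f x * g x)%:E).
Proof.
move=> mf mg f2 g2; apply/integrableP; split.
  exact/measurable_EFinP/measurable_funM.
apply: (@le_lt_trans _ _ (\int[m]_x ((f x ^+ 2)%:E + (g x ^+ 2)%:E))%E).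
  apply: ge0_le_integralT => x //=.
  rewrite -EFinD lee_fin normrM -[f x ^+ 2]real_normK ?num_real//.
  rewrite -[g x ^+ 2]real_normK ?num_real//.
  have := sqr_ge0 (`|f x| - `|g x|); move: `|f x| `|g x| (normr_ge0 (f x)) (normr_ge0 (g x)).
  by move=> a b a0 b0; nra.
rewrite ge0_integralD//; last 4 first.
- by move=> x _; rewrite lee_fin sqr_ge0.
- exact/measurable_EFinP/measurable_funX.
- by move=> x _; rewrite lee_fin sqr_ge0.
- exact/measurable_EFinP/measurable_funX.
by rewrite lte_add_pinfty.
Qed.

Lemma integrable_sq (f : T -> R) : measurable_fun setT f ->
  (\int[m]_x (f x ^+ 2)%:E < +oo)%E ->
  m.-integrable setT (fun x => (f x ^+ 2)%:E).
Proof. by move=> mf f2; exact: integrable_mul_sq. Qed.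

Lemma Rintegral_EFin (f : T -> R) : m.-integrable setT (EFin \o f) ->
  (\int[m]_x (f x)%:E)%E = (\int[m]_x f x)%R%:E.
Proof. by move=> fi; rewrite /Rintegral fineK// integrable_fin_num. Qed.

Lemma ge0_Rintegral_EFin (f : T -> R) : (forall x, 0 <= f x) ->
  (\int[m]_x (f x)%:E < +oo)%E ->
  (\int[m]_x (f x)%:E)%E = (\int[m]_x f x)%R%:E.
Proof.
move=> f0 fi; rewrite /Rintegral fineK// ge0_fin_numE//.
by apply: integral_ge0 => x _; rewrite lee_fin.
Qed.

End integral_tools.

Section variance.
Context d (T : measurableType d) (R : realType).
Variable mu : probability T R.

Lemma probability_integral_cst (r : R) : (\int[mu]_x r%:E = r%:E)%E.
Proof.
rewrite integral_cst// [X in (_ * X)%E](_ : _ = 1%E) ?mule1//.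
exact: (@probability_setT _ _ _ mu).
Qed.

Definition rvar (f : T -> R) : R := \int[mu]_x (f x - \int[mu]_y f y) ^+ 2.

Lemma rvarE (f : T -> R) : measurable_fun setT f ->
  (\int[mu]_x (f x ^+ 2)%:E < +oo)%E ->
  rvar f = \int[mu]_x (f x ^+ 2) - (\int[mu]_x f x) ^+ 2.
Proof.
move=> mf f2; rewrite /rvar; set a := \int[mu]_y f y.
have fi : mu.-integrable setT (EFin \o f).
  by apply: integrable_of_sq => //; exact: probability_setT.
have f2i := integrable_sq mf f2.
have ci : mu.-integrable setT (EFin \o (fun=> a ^+ 2)).
  by apply: finite_measure_integrable_cst.
have fai : mu.-integrable setT (EFin \o (fun x => - (2 * a) * f x)).
  by apply: eq_integrable (integrableZl measurableT (- (2 * a)) fi) => //.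
transitivity (\int[mu]_x (f x ^+ 2 + (- (2 * a) * f x + a ^+ 2))).
  by apply: eq_Rintegral => x _; ring.
rewrite RintegralD//; last by apply: eq_integrable (integrableD _ fai ci).
rewrite RintegralD// RintegralZl// Rintegral_cst// -/a.
rewrite [X in fine X](_ : _ = 1%E) ?fine1 => [|]; last exact: (@probability_setT _ _ _ mu).
ring.
Qed.

Lemma rvar_ge0 f : 0 <= rvar f.
Proof. by apply: Rintegral_ge0 => x _; exact: sqr_ge0. Qed.

Lemma sqr_Rintegral_le (f : T -> R) : measurable_fun setT f ->
  (\int[mu]_x (f x ^+ 2)%:E < +oo)%E ->
  (\int[mu]_x f x) ^+ 2 <= \int[mu]_x (f x ^+ 2).
Proof. by move=> mf f2; rewrite -subr_ge0 -rvarE// rvar_ge0. Qed.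

End variance.

Section antisymmetric_kernels.
Context d (T : measurableType d) (R : realType).
Variable mu : probability T R.
Variable k : T * T -> R.
Hypothesis mk : measurable_fun setT k.
Hypothesis kC : forall x y, k (y, x) = - k (x, y).
Hypothesis k1 : forall y, (\int[mu]_x (k (x, y) ^+ 2)%:E < +oo)%E.
Hypothesis k2 : (\int[mu \x mu]_p (k p ^+ 2)%:E < +oo)%E.

Let mean y : R := \int[mu]_x k (x, y).
Let mom2 y : R := \int[mu]_x (k (x, y) ^+ 2).

Let mk1 y : measurable_fun setT (fun x => k (x, y)).
Proof. exact: measurableT_comp. Qed.

Let mk2 : measurable_fun setT (fun p => (k p ^+ 2)%:E).
Proof. exact/measurable_EFinP/measurable_funX. Qed.

Let k1i y : mu.-integrable setT (fun x => (k (x, y))%:E).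
Proof.
by apply: (integrable_of_sq (f := fun x => k (x, y))) => //; exact: probability_setT.
Qed.

Let mom2E y : (\int[mu]_x (k (x, y) ^+ 2)%:E = (mom2 y)%:E)%E.
Proof. by apply: ge0_Rintegral_EFin => // x; exact: sqr_ge0. Qed.

Let meanE y : (\int[mu]_x (k (x, y))%:E = (mean y)%:E)%E.
Proof. exact: (Rintegral_EFin (f := fun x => k (x, y)) (k1i y)). Qed.

Let mmom2 : measurable_fun setT mom2.
Proof.
apply/measurable_EFinP; rewrite (_ : _ \o _ = fubini_G mu (fun p => (k p ^+ 2)%:E)).
  by apply: measurable_fun_fubini_tonelli_G => // p; rewrite lee_fin sqr_ge0.
by apply/funext => y /=; rewrite -mom2E.
Qed.

Let prod1 : (mu \x mu)%E setT = 1%E.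
Proof. exact: probability_setT. Qed.

Let ki : (mu \x mu)%E.-integrable setT (EFin \o k).
Proof. by apply: integrable_of_sq. Qed.

Let mmean : measurable_fun setT mean.
Proof.
apply/measurable_EFinP; rewrite (_ : _ \o _ = fubini_G mu (EFin \o k)).
  exact: (measurable_fubini_G (f := EFin \o k) ki).
by apply/funext => y /=; rewrite -meanE.
Qed.

Let mom2_int : (\int[mu]_y (mom2 y)%:E = \int[mu \x mu]_p (k p ^+ 2)%:E)%E.
Proof.
rewrite fubini_tonelli2//; last by move=> p; rewrite lee_fin sqr_ge0.
by apply: eq_integral => y _; rewrite -mom2E.
Qed.

Let mean2_fin : (\int[mu]_y (mean y ^+ 2)%:E < +oo)%E.
Proof.
apply: le_lt_trans k2; rewrite -mom2_int; apply: ge0_le_integralT => y.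
  by rewrite lee_fin sqr_ge0.
by rewrite lee_fin sqr_Rintegral_le.
Qed.

Lemma measurable_rvar_section : measurable_fun setT (fun y => rvar mu (fun x => k (x, y))).
Proof.
rewrite (_ : (fun _ => _) = (fun y => mom2 y - mean y ^+ 2)).
  by apply: measurable_funB => //; exact: measurable_funX.
by apply/funext => y; rewrite rvarE.
Qed.

(** This is the Efron-Stein inequality with equal contributions of the two
    coordinates. With [m y] the mean of [k (x, y)] over [x], antisymmetry makes
    [- m x] the mean over [y], so the cross terms of
    [E (k (x, y) + m x - m y)^2 >= 0] integrate to [2 E m^2 <= E k^2];
    subtracting [E m^2] from [E k^2] therefore loses at most one half. *)
Lemma antisym_variance : (\int[mu \x mu]_p (k p ^+ 2)%:E <=
  2%:E * \int[mu]_y (rvar mu (fun x => k (x, y)))%:E)%E.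
Proof.
pose p1 (F : T -> R) (p : T * T) := F p.1; pose p2 (F : T -> R) (p : T * T) := F p.2.
have mp1 : measurable_fun setT (p1 mean) by exact: measurableT_comp.
have mp2 : measurable_fun setT (p2 mean) by exact: measurableT_comp.
have int1 : (\int[mu \x mu]_p (p1 mean p ^+ 2)%:E = \int[mu]_y (mean y ^+ 2)%:E)%E.
  rewrite fubini_tonelli1//=; last 2 first.
  - exact/measurable_EFinP/measurable_funX.
  - by move=> p; rewrite lee_fin sqr_ge0.
  by apply: eq_integral => y _; rewrite /fubini_F /p1 /= probability_integral_cst.
have int2 : (\int[mu \x mu]_p (p2 mean p ^+ 2)%:E = \int[mu]_y (mean y ^+ 2)%:E)%E.
  rewrite fubini_tonelli2//=; last 2 first.
  - exact/measurable_EFinP/measurable_funX.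
  - by move=> p; rewrite lee_fin sqr_ge0.
  by apply: eq_integral => y _; rewrite /fubini_G /p2 /= probability_integral_cst.
have fin1 : (\int[mu \x mu]_p (p1 mean p ^+ 2)%:E < +oo)%E by rewrite int1.
have fin2 : (\int[mu \x mu]_p (p2 mean p ^+ 2)%:E < +oo)%E by rewrite int2.
pose M := \int[mu]_y (mean y ^+ 2); pose K := \int[(mu \x mu)%E]_p (k p ^+ 2).
have M2 : (\int[mu]_y (mean y ^+ 2)%:E = M%:E)%E.
  by apply: ge0_Rintegral_EFin => // y; exact: sqr_ge0.
have K2 : (\int[mu \x mu]_p (k p ^+ 2)%:E = K%:E)%E.
  by apply: ge0_Rintegral_EFin => // y; exact: sqr_ge0.
have meani : mu.-integrable setT (EFin \o mean).
  by apply: integrable_of_sq => //; exact: probability_setT.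
pose c := \int[mu]_y mean y.
have kp1 := integrable_mul_sq mk mp1 k2 fin1.
have kp2 := integrable_mul_sq mk mp2 k2 fin2.
have p12 := integrable_mul_sq mp1 mp2 fin1 fin2.
have Ekp2 : \int[(mu \x mu)%E]_p (k p * p2 mean p) = M.
  rewrite /Rintegral -integral21_prod_meas1// -[RHS]/(fine M%:E) -M2; congr fine.
  apply: eq_integral => y _; rewrite /fubini_G /p2 /=.
  under eq_integral do rewrite mulrC EFinM.
  by rewrite integralZl// meanE -EFinM.
have Ekp1 : \int[(mu \x mu)%E]_p (k p * p1 mean p) = - M.
  rewrite /Rintegral -integral12_prod_meas1//.
  rewrite -[RHS]/(fine (- M%:E)%E) -M2 -integral_ge0N; last first.
    by move=> y _; rewrite lee_fin sqr_ge0.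
  congr fine; apply: eq_integral => x _; rewrite /fubini_F /p1 /=.
  under eq_integral.
    move=> y _; rewrite kC mulrC (_ : _ * - _ = - mean x * k (y, x)) ?EFinM; last by ring.
    over.
  by rewrite integralZl// meanE -EFinM mulNr.
have Ep12 : \int[(mu \x mu)%E]_p (p1 mean p * p2 mean p) = c ^+ 2.
  rewrite /Rintegral -integral21_prod_meas1//.
  rewrite (_ : (\int[mu]_y _)%E = (\int[mu]_y (c%:E * (mean y)%:E))%E); last first.
    apply: eq_integral => y _; rewrite /fubini_G /p1 /p2 /=.
    under eq_integral do rewrite mulrC EFinM.
    by rewrite integralZl// Rintegral_EFin// muleC.
  by rewrite integralZl// Rintegral_EFin// -EFinM.
(* Integrability is established term by term along the expansion of the
   square of [k p + mean p.1 - mean p.2]. *)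
have KM : 2 * M <= K.
  have ki2 := integrable_sq mk k2; have m1i := integrable_sq mp1 fin1.
  have m2i := integrable_sq mp2 fin2.
  pose F1 p := k p ^+ 2 + p1 mean p ^+ 2; pose F2 p := F1 p + p2 mean p ^+ 2.
  pose F3 p := F2 p + 2 * (k p * p1 mean p); pose F4 p := F3 p + - 2 * (k p * p2 mean p).
  pose F5 p := F4 p + - 2 * (p1 mean p * p2 mean p).
  have i1 : (mu \x mu)%E.-integrable setT (EFin \o F1) by exact: (integrableD _ ki2 m1i).
  have i2 : (mu \x mu)%E.-integrable setT (EFin \o F2) by exact: (integrableD _ i1 m2i).
  have j3 := integrableZl measurableT 2 kp1.
  have i3 : (mu \x mu)%E.-integrable setT (EFin \o F3) by exact: (integrableD _ i2 j3).
  have j4 := integrableZl measurableT (- 2) kp2.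
  have i4 : (mu \x mu)%E.-integrable setT (EFin \o F4) by exact: (integrableD _ i3 j4).
  have j5 := integrableZl measurableT (- 2) p12.
  have : 0 <= \int[(mu \x mu)%E]_p F5 p.
    apply: Rintegral_ge0 => p _.
    have -> : F5 p = (k p + p1 mean p - p2 mean p) ^+ 2.
      by rewrite /F5 /F4 /F3 /F2 /F1; ring.
    exact: sqr_ge0.
  rewrite RintegralD// RintegralD// RintegralD// RintegralD// RintegralD//.
  rewrite !RintegralZl// Ekp1 Ekp2 Ep12 -/K.
  have -> : \int[(mu \x mu)%E]_p (p1 mean p ^+ 2) = M by rewrite /Rintegral int1 M2.
  have -> : \int[(mu \x mu)%E]_p (p2 mean p ^+ 2) = M by rewrite /Rintegral int2 M2.
  have := sqr_ge0 c; lra.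
have mom2i : mu.-integrable setT (EFin \o mom2).
  apply/integrableP; split; first exact/measurable_EFinP.
  apply: le_lt_trans k2; rewrite -mom2_int; apply: ge0_le_integralT => y //=.
  by rewrite lee_fin ger0_norm// Rintegral_ge0// => x _; exact: sqr_ge0.
have -> : (\int[mu]_y (rvar mu (fun x => k (x, y)))%:E = (K - M)%:E)%E.
  rewrite EFinB -K2 -mom2_int -M2 -integralB//; last exact: integrable_sq.
  by apply: eq_integral => y _; rewrite rvarE.
by rewrite K2 -EFinM lee_fin; lra.
Qed.

End antisymmetric_kernels.

(** * The law of the process with a random initial state *)

Section path_law.
Context d dW (T : measurableType d) (W : measurableType dW) {R : realType}.
Variables (P : R.-pker T ~> W) (mu : probability T R).

(** The law of the process whose initial state has law [mu]. *)
Definition path_law : set W -> \bar R :=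
  kcomp (kprobability (measurable_cst (mu : pprobability T R) : measurable_fun [set: unit] _))
    (kernel.kernel_snd P) tt.

HB.instance Definition _ := Measure.on path_law.

Lemma ge0_integral_path_law (F : W -> \bar R) : (forall w, 0 <= F w)%E ->
  measurable_fun setT F ->
  (\int[path_law]_w F w = \int[mu]_z \int[P z]_w F w)%E.
Proof. by move=> F0 mF; rewrite integral_kcomp. Qed.

Lemma path_lawE A : path_law A = (\int[mu]_z P z A)%E.
Proof. by []. Qed.

Lemma path_law_setT : path_law setT = 1%E.
Proof.
rewrite path_lawE -[RHS](probability_integral_cst mu).
by apply: eq_integral => z _; exact: prob_kernel.
Qed.

HB.instance Definition _ := Measure_isProbability.Build _ _ _ path_law path_law_setT.

End path_law.

Section pair_laws.
Context d1 d2 (W : measurableType d1) (T : measurableType d2) {R : realType}.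

(** The rectangles form a class closed under intersection that generates the
    product sigma-algebra, so that they determine a finite measure. *)
Lemma eq_pair_law (nu : probability W R) (X Y X' Y' : W -> T) (F : T * T -> \bar R) :
  measurable_fun setT X -> measurable_fun setT Y ->
  measurable_fun setT X' -> measurable_fun setT Y' ->
  (forall A B, measurable A -> measurable B ->
    nu (X @^-1` A `&` Y @^-1` B) = nu (X' @^-1` A `&` Y' @^-1` B)) ->
  (forall p, 0 <= F p)%E -> measurable_fun setT F ->
  (\int[nu]_w F (X w, Y w) = \int[nu]_w F (X' w, Y' w))%E.
Proof.
move=> mX mY mX' mY' rect F0 mF.
have mXY : measurable_fun setT (fun w => (X w, Y w)) by exact: measurable_fun_pair.
have mXY' : measurable_fun setT (fun w => (X' w, Y' w)) by exact: measurable_fun_pair.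
have push phi : measurable_fun setT phi ->
    (\int[nu]_w F (phi w) = \int[pushforward nu phi]_p F p)%E.
  by move=> mphi; rewrite (ge0_integral_pushforward mphi)// preimage_setT.
rewrite !push//; apply: eq_measure_integral => /= S mS _.
pose C : set (set (T * T)) :=
  [set C | exists A, measurable A /\ exists B, measurable B /\ C = A `*` B].
have CI : setI_closed C.
  move=> /= _ _ [X1 [mX1 [X2 [mX2 ->]]]] [Y1 [mY1 [Y2 [mY2 ->]]]].
  rewrite -setXI; exists (X1 `&` Y1); split; first exact: measurableI.
  by exists (X2 `&` Y2); split => //; exact: measurableI.
pose push1 : {measure set (T * T) -> \bar R} :=
  measure_function_pushforward__canonical__measure_function_Measure nu mXY.
pose push2 : {measure set (T * T) -> \bar R} :=
  measure_function_pushforward__canonical__measure_function_Measure nu mXY'.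
apply: (measure_unique C (fun=> setT) _ CI _ _ push1 push2) => //.
- rewrite measurable_prod_measurableType //; congr (<<s _ >>).
  rewrite predeqE; split => [[A mA [B mB <-]]|[A [mA [B [mB ->]]]]].
    by exists A; split => //; exists B.
  by exists A => //; exists B.
- by move=> n; exists setT; split => //; exists setT; split; rewrite ?setXTT.
- by rewrite bigcup_const//; exists 0%N.
- move=> _ [A [mA [B [mB ->]]]].
  by rewrite /= /pushforward -[LHS]/(nu (X @^-1` A `&` Y @^-1` B)) rect.
- move=> n; rewrite /= /pushforward preimage_setT.
  by apply: le_lt_trans (probability_le1 nu measurableT) _; rewrite ltry.
Qed.

End pair_laws.

Section reversible_process.
Context d dW (T : measurableType d) (W : measurableType dW) {R : realType}.
Variables (Z : R -> W -> T) (P : R.-pker T ~> W) (mu : probability T R).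
Hypothesis Z_markov : markov_process Z P.
Local Notation nu := (path_law P mu).

Let mZ t : 0 <= t -> measurable_fun setT (Z t).
Proof. exact: (markov_measurable Z_markov). Qed.

Let mZA t (A : set T) : 0 <= t -> measurable A -> measurable (Z t @^-1` A).
Proof. by move=> t0 mA; rewrite -[_ @^-1` _]setTI; exact: mZ. Qed.

Lemma ae_init z (A : set T) : measurable A -> A z ->
  {ae P z, forall w, A (Z 0 w)}.
Proof.
move=> mA Az; exists (Z 0 @^-1` (~` A)); split => //.
- by apply: mZA => //; exact: measurableC.
- rewrite (markov_init Z_markov) ?diracE; last exact: measurableC.
  by rewrite memNset//= => /(_ Az).
Qed.

(** Under [P z] the event that [Z 0] lies in [A] has probability 0 or 1. *)
Lemma init_setI z (A : set T) (X : set W) : measurable A -> measurable X ->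
  P z (Z 0 @^-1` A `&` X) = ((fun z => P z X) \_ A) z.
Proof.
move=> mA mX; rewrite patchE; have m0 := mZA (lexx 0) mA.
case: ifPn => zA; last first.
  apply/eqP; rewrite -measure_le0.
  apply: (@le_trans _ _ (P z (Z 0 @^-1` A))).
    by apply: le_measure; rewrite ?inE//; exact: measurableI.
  by rewrite (markov_init Z_markov)// diracE (negbTE zA).
rewrite [RHS](measureDI _ mX m0) setIC [X in (X + _)%E](_ : _ = 0%E) ?add0e//.
apply/eqP; rewrite -measure_le0.
apply: (@le_trans _ _ (P z (Z 0 @^-1` (~` A)))).
  apply: le_measure; rewrite ?inE//; first exact: measurableD.
  by apply: mZA => //; exact: measurableC.
rewrite (markov_init Z_markov) ?diracE; last exact: measurableC.
by rewrite memNset//= => /(_ (set_mem zA)).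
Qed.

Lemma stationary_integral t (F : T -> \bar R) : stationary Z P mu -> 0 <= t ->
  (forall x, 0 <= F x)%E -> measurable_fun setT F ->
  (\int[nu]_w F (Z t w) = \int[mu]_x F x)%E.
Proof.
move=> st t0 F0 mF.
transitivity (\int[pushforward nu (Z t)]_x F x)%E.
  by rewrite (ge0_integral_pushforward (mZ t0))// preimage_setT.
apply: (@eq_measure_integral _ _ _ setT mu
  (measure_function_pushforward__canonical__measure_function_Measure nu (mZ t0))).
by move=> A mA _; exact: (st t t0 A mA).
Qed.

(** Reversibility is the symmetry of the law of [(Z 0, Z t)] on rectangles, and
    [eq_pair_law] extends it to all nonnegative functions of the pair. *)
Lemma reversible_integral t (F : T * T -> \bar R) : reversible Z P mu -> 0 <= t ->
  (forall p, 0 <= F p)%E -> measurable_fun setT F ->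
  (\int[nu]_w F (Z 0 w, Z t w) = \int[nu]_w F (Z t w, Z 0 w))%E.
Proof.
move=> rev t0 F0 mF; have m0 := mZ (lexx 0).
have mt := mZ t0.
apply: (eq_pair_law (nu := nu) m0 mt mt m0 _ F0 mF).
move=> A B mA mB; rewrite [in RHS]setIC.
apply: etrans (path_lawE P mu _) (etrans _ (esym (path_lawE P mu _))).
rewrite (eq_integral _ _ (fun z _ => init_setI z mA (mZA t0 mB))).
rewrite (eq_integral _ _ (fun z _ => init_setI z mB (mZA t0 mA))).
by rewrite -!integral_mkcond rev.
Qed.

End reversible_process.

(** * Functional calculus over an algebraically closed field *)

Local Open Scope sesquilinear_scope.

Section spectral_calculus.
Context {C : numClosedFieldType}.

Lemma hermP n (A : 'M[C]_n) : reflect (A ^t* = A) (A \is hermsymmx).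
Proof.
apply: (iffP (is_hermitianmxP _ _ _)); rewrite expr0 scale1r => e; exact/esym.
Qed.

Lemma adjE m n (A : 'M[C]_(m, n)) i j : (A ^t*) j i = (A i j)^*.
Proof. by rewrite mxE mxE. Qed.

Lemma tr_mul_unitary m n p (U : 'M[C]_(m, n)) (X : 'M[C]_(p, m)) :
  U \is unitarymx -> \tr (X *m U *m (X *m U) ^t*) = \tr (X *m X ^t*).
Proof.
by move=> /unitarymxP UU; rewrite trmx_mul map_mxM mulmxA -(mulmxA X) UU mulmx1.
Qed.

Variable n : nat.
Implicit Types A B : 'M[C]_n.

(** The functional calculus for arbitrary functions of the eigenvalues, over
    which trace identities are identities of a commutative ring; [mxfun] is the
    case of a real function of their real parts. *)
Definition specfun (phi : C -> C) A : 'M[C]_n :=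
  invmx (spectralmx A) *m diag_mx (map_mx phi (spectral_diag A))
    *m spectralmx A.

Lemma specfunE phi A : specfun phi A =
  (spectralmx A) ^t* *m diag_mx (map_mx phi (spectral_diag A)) *m spectralmx A.
Proof. by rewrite /specfun invmx_unitary ?spectral_unitarymx. Qed.

Lemma specfun_ext phi psi A :
  (forall i, phi (spectral_diag A 0 i) = psi (spectral_diag A 0 i)) ->
  specfun phi A = specfun psi A.
Proof.
by move=> e; rewrite /specfun; congr (_ *m diag_mx _ *m _); apply/rowP => i; rewrite !mxE.
Qed.

Lemma specfunM phi psi A :
  specfun phi A *m specfun psi A = specfun (fun x => phi x * psi x) A.
Proof.
rewrite !specfunE !mulmxA mulmxtVK ?spectral_unitarymx//; congr (_ *m _).
rewrite -mulmxA; congr (_ *m _); rewrite mulmx_diag; congr diag_mx.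
by apply/rowP => i; rewrite !mxE.
Qed.

Lemma specfunD phi psi A :
  specfun phi A + specfun psi A = specfun (fun x => phi x + psi x) A.
Proof.
rewrite !specfunE -mulmxDl -mulmxDr; congr (_ *m _ *m _).
by rewrite -raddfD /=; congr diag_mx; apply/rowP => i; rewrite !mxE.
Qed.

Lemma specfunN phi A : specfun (fun x => - phi x) A = - specfun phi A.
Proof.
rewrite !specfunE -mulNmx -mulmxN; congr (_ *m _ *m _).
by rewrite -raddfN /=; congr diag_mx; apply/rowP => i; rewrite !mxE.
Qed.

Lemma specfun1 A : specfun (fun=> 1) A = 1%:M.
Proof.
rewrite /specfun (_ : map_mx _ _ = const_mx 1); last first.
  by apply/rowP => i; rewrite !mxE.
by rewrite diag_const_mx mulmx1 mulVmx ?spectral_unit.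
Qed.

Lemma specfun_id A : A \is hermsymmx -> specfun id A = A.
Proof.
move=> hA; rewrite [RHS](orthomx_spectralP (hermitian_normalmx hA)) /specfun.
by congr (_ *m diag_mx _ *m _); apply/rowP => i; rewrite !mxE.
Qed.

Lemma specfun_herm phi A : (forall x, (phi x)^* = phi x) ->
  specfun phi A \is hermsymmx.
Proof.
move=> phiR; apply/hermP; rewrite specfunE !trmx_mul !map_mxM trmxCK mulmxA.
congr (_ *m _ *m _); rewrite tr_diag_mx map_diag_mx; congr diag_mx.
by apply/rowP => i; rewrite !mxE; exact: phiR.
Qed.

(** Cyclicity of the trace leaves only the unitary matrix [W] that passes from
    one eigenbasis to the other. *)
Lemma tr_specfunM phi psi A B (W := spectralmx A *m (spectralmx B) ^t*) :
  \tr (specfun phi A *m specfun psi B) = \sum_i \sum_j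
   (W i j * (W i j)^*) * (phi (spectral_diag A 0 i) * psi (spectral_diag B 0 j)).
Proof.
rewrite !specfunE; move: (spectralmx A) (spectralmx B) @W => U V.
move: (spectral_diag A) (spectral_diag B) => a b W.
have -> : U ^t* *m diag_mx (map_mx phi a) *m U *m
    (V ^t* *m diag_mx (map_mx psi b) *m V) =
  U ^t* *m (diag_mx (map_mx phi a) *m (W *m diag_mx (map_mx psi b) *m V)).
  by rewrite /W !mulmxA.
rewrite mxtrace_mulC.
have -> : diag_mx (map_mx phi a) *m (W *m diag_mx (map_mx psi b) *m V) *m U ^t* =
   diag_mx (map_mx phi a) *m W *m (diag_mx (map_mx psi b) *m W ^t*).
  by rewrite /W trmx_mul map_mxM trmxCK !mulmxA.
move: W => W; rewrite /mxtrace; apply: eq_bigr => i _.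
rewrite mxE; apply: eq_bigr => j _.
rewrite !mul_diag_mx !mxE; ring.
Qed.

Lemma tr_specfun phi A :
  \tr (specfun phi A) = \sum_i phi (spectral_diag A 0 i).
Proof.
rewrite /specfun mxtrace_mulC mulmxA mulmxV ?spectral_unit// mul1mx mxtrace_diag.
by apply: eq_bigr => i _; rewrite mxE.
Qed.

(** Weights common to all trace expressions in a function of [A] and a function
    of [B]: an inequality between such traces follows from the scalar
    inequality for each pair of eigenvalues. *)
Definition cpx_overlap A B (i j : 'I_n) : C :=
  let w := (spectralmx A *m (spectralmx B) ^t*) i j in w * w^*.

Lemma tr_specfun_l phi A B : \tr (specfun phi A) =
  \sum_i \sum_j cpx_overlap A B i j * phi (spectral_diag A 0 i).
Proof.
transitivity (\tr (specfun phi A *m specfun (fun=> 1) B)).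
  by rewrite specfun1 mulmx1.
rewrite tr_specfunM; apply: eq_bigr => i _; apply: eq_bigr => j _.
by rewrite mulr1.
Qed.

Lemma tr_specfun_r phi A B : \tr (specfun phi B) =
  \sum_i \sum_j cpx_overlap A B i j * phi (spectral_diag B 0 j).
Proof.
transitivity (\tr (specfun (fun=> 1) A *m specfun phi B)).
  by rewrite specfun1 mul1mx.
rewrite tr_specfunM; apply: eq_bigr => i _; apply: eq_bigr => j _.
by rewrite mul1r.
Qed.

Lemma tr_sqB (X Y : 'M[C]_n) : \tr ((X - Y) *m (X - Y)) =
  \tr (X *m X) - 2 * \tr (X *m Y) + \tr (Y *m Y).
Proof. by rewrite mulmxBl !mulmxBr !raddfB /= (mxtrace_mulC Y X); ring. Qed.

(** Commutation brings each term into the form of a product of [X] and [M]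
    times a power of [Y], which expands in two eigenbases when [M] is a
    function of [X]. *)
Lemma tr_sqBM (X Y M : 'M[C]_n) : X *m M = M *m X ->
  \tr ((X - Y) *m (X - Y) *m M) =
  \tr (X *m X *m M) - 2 * \tr (X *m M *m Y) + \tr (M *m (Y *m Y)).
Proof.
move=> XM; rewrite mulmxBl !mulmxBr !mulmxBl !raddfB /=.
have -> : \tr (X *m Y *m M) = \tr (X *m M *m Y).
  by rewrite mxtrace_mulC mulmxA -XM.
have -> : \tr (Y *m X *m M) = \tr (X *m M *m Y).
  by rewrite -mulmxA mxtrace_mulC.
rewrite (mxtrace_mulC (Y *m Y)); ring.
Qed.

(** The Hilbert-Schmidt geometry of functions of two matrices reduces to scalars,
    because the squared terms carry the same overlaps as the cross term: the
    rows and the columns of the overlap matrix have sum 1. *)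
Lemma tr_specfun_sqB phi psi A B :
  \tr ((specfun phi A - specfun psi B) *m (specfun phi A - specfun psi B)) =
  \sum_i \sum_j cpx_overlap A B i j *
    (phi (spectral_diag A 0 i) - psi (spectral_diag B 0 j)) ^+ 2.
Proof.
rewrite tr_sqB !specfunM tr_specfunM (tr_specfun_l _ A B) (tr_specfun_r _ A B).
rewrite mulr_sumr -sumrN -!big_split /=.
apply: eq_bigr => i _; rewrite mulr_sumr -sumrN -!big_split /=.
by apply: eq_bigr => j _; rewrite /cpx_overlap /=; ring.
Qed.

Lemma tr_sqB_specfun chi A B : A \is hermsymmx -> B \is hermsymmx ->
  \tr ((A - B) *m (A - B) *m specfun chi A) =
  \sum_i \sum_j cpx_overlap A B i j *
    ((spectral_diag A 0 i - spectral_diag B 0 j) ^+ 2 *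
     chi (spectral_diag A 0 i)).
Proof.
move=> hA hB; have hA2 := specfun_id hA; have hB2 := specfun_id hB.
have AA : A *m A = specfun (fun x => x * x) A by rewrite -(specfunM id id) hA2.
have BB : B *m B = specfun (fun x => x * x) B by rewrite -(specfunM id id) hB2.
have AM : A *m specfun chi A = specfun (fun x => x * chi x) A.
  by rewrite -(specfunM id) hA2.
have MA : specfun chi A *m A = specfun (fun x => x * chi x) A.
  transitivity (specfun chi A *m specfun id A); first by rewrite hA2.
  by rewrite specfunM; apply: specfun_ext => i; rewrite mulrC.
have trAB : \tr (specfun (fun x => x * chi x) A *m B) =
    \tr (specfun (fun x => x * chi x) A *m specfun id B) by rewrite hB2.
rewrite tr_sqBM ?AM ?MA// AA BB specfunM trAB !tr_specfunM.
rewrite (tr_specfun_l _ A B) mulr_sumr -!sumrN -!big_split /=.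
apply: eq_bigr => i _; rewrite mulr_sumr -!sumrN -!big_split /=.
by apply: eq_bigr => j _; rewrite /cpx_overlap /=; ring.
Qed.

Lemma tr_specfun_mulB phi A B : A \is hermsymmx -> B \is hermsymmx ->
  \tr (specfun phi A *m (B - A)) =
  \sum_i \sum_j cpx_overlap A B i j *
    (phi (spectral_diag A 0 i) * (spectral_diag B 0 j - spectral_diag A 0 i)).
Proof.
move=> hA hB; have hA2 := specfun_id hA; have hB2 := specfun_id hB.
have trAB : \tr (specfun phi A *m B) = \tr (specfun phi A *m specfun id B).
  by rewrite hB2.
have trAA : \tr (specfun phi A *m A) = \tr (specfun (fun x => phi x * x) A).
  by rewrite -(specfunM phi id) hA2.
rewrite mulmxBr raddfB /= trAB trAA tr_specfunM.
rewrite (tr_specfun_l _ A B) -!sumrN -!big_split /=.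
apply: eq_bigr => i _; rewrite -!sumrN -!big_split /=.
by apply: eq_bigr => j _; rewrite /cpx_overlap /=; ring.
Qed.

Lemma specfun_eigenvector phi A i (u := (row i (spectralmx A)) ^t*) :
  specfun phi A *m u = phi (spectral_diag A 0 i) *: u.
Proof.
rewrite /u specfunE -map_trmx; set U := spectralmx A; set D := map_mx phi _.
have -> : (row i U)^T = U^T *m (delta_mx i 0 : 'cV_n).
  by rewrite rowE trmx_mul trmx_delta.
rewrite map_mxM map_delta_mx -!mulmxA (mulmxA U) (unitarymxP (spectral_unitarymx A)).
rewrite mul1mx scalemxAr; congr (_ *m _); first by rewrite map_trmx.
apply/matrixP => k j; by rewrite mul_diag_mx !mxE; case: eqP => [->|_] //; rewrite !mulr0.
Qed.

End spectral_calculus.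

(** * Real coordinates and the Hilbert-Schmidt norm *)

Local Open Scope complex_scope.

Section complex_coordinates.
Context {R : realType}.
Implicit Types x y : R[i].

Lemma cReD x y : complex.Re (x + y) = complex.Re x + complex.Re y.
Proof. by case: x y => [? ?] [? ?]. Qed.
Lemma cImD x y : complex.Im (x + y) = complex.Im x + complex.Im y.
Proof. by case: x y => [? ?] [? ?]. Qed.
Lemma cReN x : complex.Re (- x) = - complex.Re x.
Proof. by case: x. Qed.
Lemma cImN x : complex.Im (- x) = - complex.Im x.
Proof. by case: x. Qed.
Lemma cReM x y : complex.Re (x * y) =
  complex.Re x * complex.Re y - complex.Im x * complex.Im y.
Proof. by case: x y => [? ?] [? ?]. Qed.
Lemma cImM x y : complex.Im (x * y) =
  complex.Re x * complex.Im y + complex.Im x * complex.Re y.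
Proof. by case: x y => [? ?] [? ?]. Qed.
Lemma cReJ x : complex.Re (x^*)%R = complex.Re x.
Proof. by case: x. Qed.
Lemma cImJ x : complex.Im (x^*)%R = - complex.Im x.
Proof. by case: x. Qed.
Lemma cReJM x y : complex.Re ((x^*)%R * y) =
  complex.Re x * complex.Re y + complex.Im x * complex.Im y.
Proof. by rewrite cReM cReJ cImJ mulNr opprK. Qed.
Lemma cReRM (r : R) x : complex.Re (r%:C * x) = r * complex.Re x.
Proof. by rewrite cReM /= mul0r subr0. Qed.
Lemma cImRM (r : R) x : complex.Im (r%:C * x) = r * complex.Im x.
Proof. by rewrite cImM /= mul0r addr0. Qed.
Lemma cRe_sum I (r : seq I) (p : pred I) (F : I -> R[i]) :
  complex.Re (\sum_(i <- r | p i) F i) = \sum_(i <- r | p i) complex.Re (F i).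
Proof. exact: (big_morph _ cReD (erefl : complex.Re (0 : R[i]) = 0)). Qed.
Lemma cIm_sum I (r : seq I) (p : pred I) (F : I -> R[i]) :
  complex.Im (\sum_(i <- r | p i) F i) = \sum_(i <- r | p i) complex.Im (F i).
Proof. exact: (big_morph _ cImD (erefl : complex.Im (0 : R[i]) = 0)). Qed.

Definition sqn (x : R[i]) : R := complex.Re x ^+ 2 + complex.Im x ^+ 2.

Lemma sqn_ge0 x : 0 <= sqn x.
Proof. by rewrite addr_ge0// sqr_ge0. Qed.

Lemma mulcJ x : x * (x^*)%R = (sqn x)%:C.
Proof.
by apply/eqP; rewrite eq_complex cReM cImM cReJ cImJ /sqn /=; apply/andP; split;
  apply/eqP; ring.
Qed.

Lemma sqnJ x : sqn (x^*)%R = sqn x.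
Proof. by rewrite /sqn cReJ cImJ sqrrN. Qed.

Lemma sqnM x y : sqn (x * y) = sqn x * sqn y.
Proof. by rewrite /sqn cReM cImM; ring. Qed.

Lemma sqn_eq0 x : sqn x = 0 -> x = 0.
Proof.
move/eqP; rewrite paddr_eq0 ?sqr_ge0// !sqrf_eq0 => /andP[/eqP a /eqP b].
by apply/eqP; rewrite eq_complex a b /= eqxx.
Qed.

End complex_coordinates.

Section frobenius.
Context {R : realType}.

(** The squared Hilbert-Schmidt norm. *)
Definition frob2 m n (X : 'M[R[i]]_(m, n)) : R := \sum_i \sum_j sqn (X i j).

Lemma frob2_ge0 m n (X : 'M[R[i]]_(m, n)) : 0 <= frob2 X.
Proof. by apply: sumr_ge0 => i _; apply: sumr_ge0 => j _; exact: sqn_ge0. Qed.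

Lemma frob20 m n : frob2 (0 : 'M[R[i]]_(m, n)) = 0.
Proof.
rewrite /frob2 big1// => i _; rewrite big1// => j _.
by rewrite mxE /sqn /= expr0n addr0.
Qed.

Lemma frob2E m n (X : 'M[R[i]]_(m, n)) : \tr (X *m X ^t*) = (frob2 X)%:C.
Proof.
rewrite /mxtrace /frob2 rmorph_sum; apply: eq_bigr => i _.
rewrite mxE rmorph_sum; apply: eq_bigr => j _.
by rewrite adjE mulcJ.
Qed.

Lemma frob2_unitary m n p (U : 'M[R[i]]_(m, n)) (X : 'M[R[i]]_(p, m)) :
  U \is unitarymx -> frob2 (X *m U) = frob2 X.
Proof. by move=> UU; apply: (@complexI R); rewrite -!frob2E tr_mul_unitary. Qed.

Lemma frob2_trC m n (X : 'M[R[i]]_(m, n)) : frob2 (X ^t*) = frob2 X.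
Proof.
rewrite /frob2 exchange_big; apply: eq_bigr => i _; apply: eq_bigr => j _.
by rewrite adjE sqnJ.
Qed.

Lemma frob2_eq0 m n (X : 'M[R[i]]_(m, n)) : frob2 X = 0 -> X = 0.
Proof.
move/eqP; rewrite /frob2 psumr_eq0 => [/allP X0|i _]; last first.
  by apply: sumr_ge0 => j _; exact: sqn_ge0.
apply/matrixP => i j; rewrite mxE; apply: sqn_eq0; apply/eqP.
have /= := X0 i (mem_index_enum _); rewrite psumr_eq0 => [/allP|k _]; last first.
  exact: sqn_ge0.
by move=> /(_ j (mem_index_enum _)).
Qed.

Lemma herm_frob2 n (A : 'M[R[i]]_n) : A \is hermsymmx ->
  \tr (A *m A) = (frob2 A)%:C.
Proof. by move/hermP => h; rewrite -frob2E h. Qed.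

Lemma hermD n (A B : 'M[R[i]]_n) :
  A \is hermsymmx -> B \is hermsymmx -> A + B \is hermsymmx.
Proof.
by move=> /hermP hA /hermP hB; apply/hermP; rewrite linearD map_mxD hA hB.
Qed.

Lemma hermN n (A : 'M[R[i]]_n) : A \is hermsymmx -> - A \is hermsymmx.
Proof. by move=> /hermP hA; apply/hermP; rewrite linearN map_mxN hA. Qed.

Lemma hermB n (A B : 'M[R[i]]_n) :
  A \is hermsymmx -> B \is hermsymmx -> A - B \is hermsymmx.
Proof. by move=> hA hB; rewrite hermD ?hermN. Qed.

Lemma conjCR (c : R) : ((c%:C)^*)%R = c%:C.
Proof. by apply/eqP; rewrite eq_complex cReJ cImJ /= oppr0 !eqxx. Qed.

Lemma hermZ n (c : R) (A : 'M[R[i]]_n) :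
  A \is hermsymmx -> c%:C *: A \is hermsymmx.
Proof.
by move=> /hermP hA; apply/hermP; rewrite linearZ /= map_mxZ hA; congr (_ *: _);
  exact: conjCR.
Qed.

End frobenius.

Section functional_calculus.
Context {R : realType} {n : nat}.
Implicit Types (A B : 'M[R[i]]_n) (phi psi chi : R -> R).

Definition eig A (i : 'I_n) : R := complex.Re (spectral_diag A 0 i).

(** The squared moduli of the inner products of the eigenvectors of [A] with
    those of [B]; they form a doubly stochastic matrix. *)
Definition overlap A B (i j : 'I_n) : R :=
  sqn ((spectralmx A *m (spectralmx B) ^t*) i j).

Lemma overlap_ge0 A B i j : 0 <= overlap A B i j.
Proof. exact: sqn_ge0. Qed.

Lemma overlapC A B i j : overlap A B i j = overlap B A j i.
Proof.
rewrite /overlap -sqnJ -adjE; congr (sqn (_ j i)).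
by rewrite trmx_mul map_mxM trmxCK.
Qed.

Lemma cpx_overlapE A B i j : cpx_overlap A B i j = (overlap A B i j)%:C.
Proof. exact: mulcJ. Qed.

Lemma eigE A i : A \is hermsymmx -> spectral_diag A 0 i = (eig A i)%:C.
Proof.
move=> hA; apply/esym/RRe_real.
by move/mxOverP: (hermitian_spectral_diag_real hA); apply.
Qed.

Lemma mxfunE phi A : mxfun phi A = specfun (fun x => (phi (complex.Re x))%:C) A.
Proof. by []. Qed.

Lemma eq_mxfun phi psi A : phi =1 psi -> mxfun phi A = mxfun psi A.
Proof. by move=> /funext ->. Qed.

Lemma mxfunM phi psi A :
  mxfun phi A *m mxfun psi A = mxfun (fun x => phi x * psi x) A.
Proof. by rewrite !mxfunE specfunM; apply: specfun_ext => i; rewrite rmorphM. Qed.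

Lemma mxfunD phi psi A :
  mxfun phi A + mxfun psi A = mxfun (fun x => phi x + psi x) A.
Proof. by rewrite !mxfunE specfunD; apply: specfun_ext => i; rewrite rmorphD. Qed.

Lemma mxfun1 A : mxfun (fun=> 1) A = 1%:M.
Proof. exact: specfun1. Qed.

Lemma mxfunN phi A : mxfun (fun x => - phi x) A = - mxfun phi A.
Proof. by rewrite !mxfunE -specfunN; apply: specfun_ext => i; rewrite rmorphN. Qed.

Lemma mxfun_id A : A \is hermsymmx -> mxfun id A = A.
Proof.
move=> hA; apply: etrans (specfun_id hA); rewrite mxfunE.
by apply: specfun_ext => i; rewrite (eigE i hA).
Qed.

Lemma mxfun_herm phi A : mxfun phi A \is hermsymmx.
Proof. by apply: specfun_herm => x; rewrite conjCR. Qed.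

Let sumC (F : 'I_n -> 'I_n -> R) (w : 'I_n -> 'I_n -> R) :
  complex.Re (\sum_i \sum_j (w i j)%:C * (F i j)%:C) =
  \sum_i \sum_j w i j * F i j.
Proof.
rewrite cRe_sum; apply: eq_bigr => i _; rewrite cRe_sum; apply: eq_bigr => j _.
by rewrite -rmorphM.
Qed.

Lemma tr_mxfun phi A : complex.Re (\tr (mxfun phi A)) = \sum_i phi (eig A i).
Proof. by rewrite mxfunE tr_specfun cRe_sum. Qed.

Lemma tr_mxfun_l phi A B : complex.Re (\tr (mxfun phi A)) =
  \sum_i \sum_j overlap A B i j * phi (eig A i).
Proof.
rewrite mxfunE (tr_specfun_l _ A B) -sumC; congr complex.Re.
by apply: eq_bigr => i _; apply: eq_bigr => j _; rewrite cpx_overlapE.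
Qed.

Lemma tr_mxfun_r phi A B : complex.Re (\tr (mxfun phi B)) =
  \sum_i \sum_j overlap A B i j * phi (eig B j).
Proof.
rewrite mxfunE (tr_specfun_r _ A B) -sumC; congr complex.Re.
by apply: eq_bigr => i _; apply: eq_bigr => j _; rewrite cpx_overlapE.
Qed.

Lemma overlap_sum A B : \sum_i \sum_j overlap A B i j = n%:R.
Proof.
transitivity (\sum_(i < n) (1 : R)); last by rewrite sumr_const card_ord.
rewrite -(tr_mxfun (fun=> 1) A) (tr_mxfun_l _ A B).
by apply: eq_bigr => i _; apply: eq_bigr => j _; rewrite mulr1.
Qed.

Lemma frob2_mxfun phi A :
  frob2 (mxfun phi A) = complex.Re (\tr (mxfun (fun x => phi x * phi x) A)).
Proof. by rewrite -mxfunM herm_frob2 ?mxfun_herm. Qed.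

Lemma frob2_mxfunB phi psi A B : frob2 (mxfun phi A - mxfun psi B) =
  \sum_i \sum_j overlap A B i j * (phi (eig A i) - psi (eig B j)) ^+ 2.
Proof.
have h : mxfun phi A - mxfun psi B \is hermsymmx.
  by apply: hermB; exact: mxfun_herm.
have -> : frob2 (mxfun phi A - mxfun psi B) =
  complex.Re (frob2 (mxfun phi A - mxfun psi B))%:C by [].
rewrite -(herm_frob2 h) !mxfunE tr_specfun_sqB -sumC; congr complex.Re.
apply: eq_bigr => i _; apply: eq_bigr => j _.
by rewrite cpx_overlapE -rmorphB rmorphXn.
Qed.

Lemma rtr_sqB_mxfun chi A B : A \is hermsymmx -> B \is hermsymmx ->
  complex.Re (\tr ((A - B) *m (A - B) *m mxfun chi A)) =
  \sum_i \sum_j overlap A B i j * ((eig A i - eig B j) ^+ 2 * chi (eig A i)).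
Proof.
move=> hA hB; rewrite mxfunE tr_sqB_specfun// -sumC; congr complex.Re.
apply: eq_bigr => i _; apply: eq_bigr => j _.
by rewrite cpx_overlapE !eigE// -rmorphB -rmorphXn -rmorphM.
Qed.

Lemma rtr_mxfun_mulB phi A B : A \is hermsymmx -> B \is hermsymmx ->
  complex.Re (\tr (mxfun phi A *m (B - A))) =
  \sum_i \sum_j overlap A B i j * (phi (eig A i) * (eig B j - eig A i)).
Proof.
move=> hA hB; rewrite mxfunE tr_specfun_mulB// -sumC; congr complex.Re.
apply: eq_bigr => i _; apply: eq_bigr => j _.
by rewrite cpx_overlapE !eigE// -rmorphB -rmorphM.
Qed.

End functional_calculus.

(** * Hyperbolic trace inequalities *)

Section hyperbolic.
Context {R : realType}.
Implicit Types a b h : R.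

Let expRNK h : expR h * expR (- h) = 1.
Proof. by rewrite -expRD subrr expR0. Qed.

Lemma cosh_sinh a : cosh a ^+ 2 = 1 + sinh a ^+ 2.
Proof. rewrite /cosh /sinh; have := expRNK a; nra. Qed.

Lemma cosh_double a : cosh (2 * a) = 1 + 2 * sinh a ^+ 2.
Proof.
have e1 : expR (2 * a) = expR a ^+ 2 by rewrite mulr_natl mulr2n expRD expr2.
have e2 : expR (- (2 * a)) = expR (- a) ^+ 2.
  by rewrite mulr_natl mulr2n opprD expRD expr2.
rewrite /cosh /sinh e1 e2; have := expRNK a; nra.
Qed.

Lemma sinhN a : sinh (- a) = - sinh a.
Proof. by rewrite /sinh opprK; field. Qed.

Lemma cosh_ge0 a : 0 <= cosh a.
Proof. by rewrite /cosh divr_ge0// addr_ge0// expR_ge0. Qed.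

Lemma expR_le_cosh a : expR a <= 2 * cosh a.
Proof. by rewrite /cosh; have := expR_ge0 (- a); lra. Qed.

(** Both exponentials in [cosh] lie above their tangent lines. *)
Lemma cosh_tangent a b : cosh a + sinh a * (b - a) <= cosh b.
Proof.
have -> : cosh b = (expR a * expR (b - a) + expR (- a) * expR (- (b - a))) / 2.
  by rewrite -!expRD /cosh; congr ((expR _ + expR _) / 2); ring.
have := expR_ge1Dx (b - a); have := expR_ge1Dx (- (b - a)).
have := expR_gt0 a; have := expR_gt0 (- a); rewrite /cosh /sinh; nra.
Qed.

Lemma le_cosh a b : 0 <= a -> a <= b -> cosh a <= cosh b.
Proof.
move=> a0 ab; apply: le_trans (cosh_tangent a b); rewrite lerDl.
apply: mulr_ge0; last by rewrite subr_ge0.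
by rewrite /sinh divr_ge0// subr_ge0 ler_expR; lra.
Qed.

Lemma cosh_norm a : cosh `|a| = cosh a.
Proof.
case: (ger0P a) => // _; rewrite /cosh opprK; congr (_ / _); exact: addrC.
Qed.

(** By the mean value theorem [sinh h = h cosh c] for some [c] between 0 and
    [h]. *)
Lemma sqr_sinh_le_cosh h : sinh h ^+ 2 <= h ^+ 2 * cosh h ^+ 2.
Proof.
have pos a : 0 <= a -> 0 <= sinh a /\ sinh a <= a * cosh a.
  move=> a0; split; first by rewrite /sinh divr_ge0// subr_ge0 ler_expR; lra.
  have [->|an0] := eqVneq a 0.
    by rewrite /sinh oppr0 subrr !mul0r.
  have a_gt0 : 0 < a by rewrite lt_neqAle eq_sym an0.
  have der (x : R) : is_derive x 1 (@sinh R) (cosh x).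
    rewrite /sinh /cosh.
    apply: is_derive_eq.
    by rewrite /GRing.scale /=; ring.
  have [//|c] := @MVT R sinh cosh 0 a a_gt0 (fun x _ => der x).
    apply: derivable_within_continuous => x _; exact: @ex_derive _ _ _ _ _ _ _ (der x).
  rewrite in_itv /= => /andP[c0 ca].
  have -> : sinh (0 : R) = 0 by rewrite /sinh oppr0 subrr mul0r.
  rewrite !subr0 => ->; rewrite mulrC ler_pM2l// le_cosh// ltW//.
have [h0|/ltW h0] := lerP 0 h.
  by have [s0 sh] := pos _ h0; rewrite -exprMn ler_pXn2r// nnegrE mulr_ge0// cosh_ge0.
have [s0 sh] := pos (- h) (etrans (oppr_ge0 _) h0).
have <- : cosh (- h) = cosh h by rewrite /cosh opprK addrC.
rewrite -[X in X <= _]sqrrN -sinhN -(sqrrN h).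
by rewrite -exprMn ler_pXn2r// nnegrE mulr_ge0// ?cosh_ge0// oppr_ge0.
Qed.

(** In terms of half the sum [m] and half the difference [h] of [a] and [b], the
    left-hand side is [(2 cosh m sinh h) ^ 2], while the mean of the squares of
    [cosh a] and [cosh b] is at least [(cosh m cosh h) ^ 2];
    [sqr_sinh_le_cosh] compares them. *)
Lemma sinh_mean_value a b :
  (sinh a - sinh b) ^+ 2 <= (a - b) ^+ 2 * (cosh a ^+ 2 + cosh b ^+ 2) / 2.
Proof.
pose m := (a + b) / 2; pose h := (a - b) / 2.
have -> : a = m + h by rewrite /m /h; field.
have -> : b = m - h by rewrite /m /h; field.
have := sqr_sinh_le_cosh h; rewrite /sinh /cosh.
rewrite !opprD opprK !expRD.
move: (expR m) (expR (- m)) (expR h) (expR (- h)) => x x' y y' H.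
have -> : ((x * y - x' * y') / 2 - (x * y' - x' * y) / 2) ^+ 2 =
  (x + x') ^+ 2 * ((y - y') / 2) ^+ 2 by field.
have -> : m + h + (- m + h) = 2 * h by ring.
apply: (@le_trans _ _ ((x + x') ^+ 2 * (h ^+ 2 * ((y + y') / 2) ^+ 2))).
  by rewrite ler_wpM2l// sqr_ge0.
have -> : (2 * h) ^+ 2 * (((x * y + x' * y') / 2) ^+ 2 +
   ((x * y' + x' * y) / 2) ^+ 2) / 2 =
  h ^+ 2 * (((x * y + x' * y') ^+ 2 + (x * y' + x' * y) ^+ 2) / 2) by field.
rewrite mulrCA ler_wpM2l ?sqr_ge0//.
have := sqr_ge0 ((x * y + x' * y') - (x * y' + x' * y)); nra.
Qed.

End hyperbolic.

Section trace_inequalities.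
Context {R : realType} {n : nat}.
Implicit Types A B : 'M[R[i]]_n.
Local Notation rtr X := (complex.Re (\tr X)).

(** Both sides expand with the same weights [overlap A B i j], against which
    [sinh_mean_value] is applied to each pair of eigenvalues. *)
Lemma sinh_trace_chain A B : A \is hermsymmx -> B \is hermsymmx ->
  frob2 (mxfun sinh A - mxfun sinh B) <=
  (rtr ((A - B) *m (A - B) *m mxfun (fun x => cosh x ^+ 2) A) +
   rtr ((B - A) *m (B - A) *m mxfun (fun x => cosh x ^+ 2) B)) / 2.
Proof.
move=> hA hB.
have E1 := rtr_sqB_mxfun (fun x => cosh x ^+ 2) hA hB.
have E2 := rtr_sqB_mxfun (fun x => cosh x ^+ 2) hB hA.
have eq_bound (a b c a' b' c' : R) : a = a' -> b = b' -> c = c' ->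
  a' <= (b' + c') / 2 -> a <= (b + c) / 2 by move=> -> -> ->.
apply: (eq_bound _ _ _ _ _ _ (frob2_mxfunB sinh sinh A B) E1 E2).
rewrite [X in _ + X]exchange_big /= -big_split /= mulr_suml; apply: ler_sum => i _.
rewrite -big_split /= mulr_suml; apply: ler_sum => j _.
rewrite (overlapC B A) -mulrDr -mulrA ler_wpM2l ?overlap_ge0//.
have := sinh_mean_value (eig A i) (eig B j); nra.
Qed.

(** The eigenbases chosen for [A] and for [- A] may differ. The squared
    Hilbert-Schmidt norm of [A - A = 0], expanded in both, shows that an
    overlap vanishes unless the two eigenvalues are opposite, and then the same
    expansion for [phi] vanishes too. *)
Lemma mxfun_odd phi A : (forall x : R, phi (- x) = - phi x) ->
  A \is hermsymmx -> mxfun phi (- A) = - mxfun phi A.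
Proof.
move=> odd hA; have hNA := hermN hA.
have : frob2 (mxfun id A - mxfun -%R (- A)) = 0.
  by rewrite (mxfunN id) !mxfun_id// opprK subrr frob20.
rewrite frob2_mxfunB => /eqP; rewrite psumr_eq0; last first.
  by move=> i _; apply: sumr_ge0 => j _; rewrite mulr_ge0 ?overlap_ge0 ?sqr_ge0.
move=> /allP H.
suff : frob2 (mxfun phi A - mxfun (fun x => - phi x) (- A)) = 0.
  by move=> /frob2_eq0/eqP; rewrite mxfunN opprK addr_eq0 => /eqP ->; rewrite opprK.
rewrite frob2_mxfunB big1// => i _; rewrite big1// => j _.
have := H i (mem_index_enum _) => /=; rewrite psumr_eq0; last first.
  by move=> k _; rewrite mulr_ge0 ?overlap_ge0 ?sqr_ge0.
move=> /allP /(_ j (mem_index_enum _)) /=; rewrite mulf_eq0 => /orP[/eqP->|].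
  by rewrite mul0r.
rewrite sqrf_eq0 opprK addr_eq0 => /eqP ->.
by rewrite odd opprK addNr expr0n mulr0.
Qed.

(** Klein's inequality for [cosh (2 x)], the right-hand side being the trace of
    [cosh (2 B)]. The second term is linear in [B], so that it drops out when
    [B] is random with mean [A]: the integrated form is Jensen's inequality. *)
Lemma cosh_trace_tangent A B : A \is hermsymmx -> B \is hermsymmx ->
  rtr (mxfun (fun x => cosh (2 * x)) A) +
    rtr (mxfun (fun x => 2 * sinh (2 * x)) A *m (B - A)) <=
  n%:R + 2 * frob2 (mxfun sinh B).
Proof.
move=> hA hB; rewrite rtr_mxfun_mulB// (tr_mxfun_l _ A B) frob2_mxfun.
rewrite (tr_mxfun_r _ A B) -(overlap_sum A B) mulr_sumr -!big_split /=.
apply: ler_sum => i _; rewrite mulr_sumr -!big_split /=.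
apply: ler_sum => j _.
rewrite -mulrDr (_ : _ + 2 * _ =
  overlap A B i j * (1 + 2 * sinh (eig B j) ^+ 2)); last by ring.
rewrite ler_wpM2l ?overlap_ge0//.
have := cosh_tangent (2 * eig A i) (2 * eig B j); rewrite (cosh_double (eig B j)); lra.
Qed.

Lemma mxfun_cosh2 A : mxfun cosh A ^+ 2 = mxfun (fun x => cosh x ^+ 2) A.
Proof. exact: mxfunM. Qed.

Lemma mxfun_cosh2_sinh A :
  mxfun (fun x => cosh x ^+ 2) A = 1%:M + mxfun sinh A *m mxfun sinh A.
Proof.
rewrite mxfunM -(mxfun1 A) mxfunD; apply: eq_mxfun => x.
by rewrite -!expr2 cosh_sinh.
Qed.

Lemma rtr_cosh2 A :
  rtr (mxfun (fun x => cosh x ^+ 2) A) = n%:R + frob2 (mxfun sinh A).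
Proof.
apply: etrans (tr_mxfun _ _) _; rewrite frob2_mxfun.
apply: etrans (congr1 (fun r => n%:R + r) (esym (tr_mxfun _ _))).
have -> : n%:R = \sum_(i < n) (1 : R) by rewrite sumr_const card_ord.
by rewrite -big_split /=; apply: eq_bigr => i _; rewrite -expr2 cosh_sinh.
Qed.

End trace_inequalities.

(** * The operator norm *)

Section operator_norm.
Context {R : realType}.

Lemma l2normE n (v : 'cV[R[i]]_n) : l2norm v = Num.sqrt (frob2 v).
Proof.
congr Num.sqrt; rewrite /frob2; apply: eq_bigr => i _.
by rewrite big_ord_recl big_ord0 addr0.
Qed.

Lemma l2norm_ge0 n (v : 'cV[R[i]]_n) : 0 <= l2norm v.
Proof. exact: sqrtr_ge0. Qed.

Lemma sqr_l2norm n (v : 'cV[R[i]]_n) : l2norm v ^+ 2 = frob2 v.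
Proof. by rewrite l2normE sqr_sqrtr// frob2_ge0. Qed.

Lemma frob2Z m n (c : R) (X : 'M[R[i]]_(m, n)) :
  frob2 (c%:C *: X) = c ^+ 2 * frob2 X.
Proof.
rewrite /frob2 mulr_sumr; apply: eq_bigr => i _.
rewrite mulr_sumr; apply: eq_bigr => j _.
by rewrite mxE sqnM /sqn /= expr0n addr0.
Qed.

Lemma l2normZ n (c : R) (v : 'cV[R[i]]_n) :
  0 <= c -> l2norm (c%:C *: v) = c * l2norm v.
Proof.
by move=> c0; rewrite !l2normE frob2Z sqrtrM ?sqr_ge0// sqrtr_sqr ger0_norm.
Qed.

Lemma frob2_delta m n (i : 'I_m) (j : 'I_n) :
  frob2 (delta_mx i j : 'M[R[i]]_(m, n)) = 1.
Proof.
rewrite /frob2 (bigD1 i)//= (bigD1 j)//= mxE !eqxx /=.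
rewrite big1 => [|k /negbTE kj]; last first.
  by rewrite mxE kj andbF /sqn /= expr0n addr0.
rewrite big1 => [|k /negbTE ki]; first by rewrite /sqn /= expr1n expr0n !addr0.
by rewrite big1// => l _; rewrite mxE ki /sqn /= expr0n addr0.
Qed.

Lemma l2norm_eq0 n (v : 'cV[R[i]]_n) : l2norm v = 0 -> v = 0.
Proof. by move=> v0; apply: frob2_eq0; rewrite -sqr_l2norm v0 expr0n. Qed.

Let sq2 (x y : R) : (x + y) ^+ 2 <= 2 * x ^+ 2 + 2 * y ^+ 2.
Proof. by have := sqr_ge0 (x - y); nra. Qed.

Let sqn_sum_le I (r : seq I) (F : I -> R[i]) :
  sqn (\sum_(i <- r) F i) <= 2 ^+ size r * \sum_(i <- r) sqn (F i).
Proof.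
elim: r => [|a r IH]; first by rewrite !big_nil mulr0 /sqn /= expr0n addr0.
rewrite !big_cons exprS; set S := \sum_(i <- r) F i in IH *.
set T := \sum_(i <- r) sqn (F i) in IH *.
have T0 : 0 <= T by apply: sumr_ge0 => i _; exact: sqn_ge0.
have S2 : sqn (F a + S) <= 2 * sqn (F a) + 2 * sqn S.
  rewrite /sqn cReD cImD; apply: le_trans (lerD (sq2 _ _) (sq2 _ _)) _.
  by rewrite le_eqVlt; apply/orP; left; apply/eqP; ring.
have p1 : 1 <= (2 : R) ^+ size r by rewrite exprn_ege1// ler1n.
have pF : sqn (F a) <= 2 ^+ size r * sqn (F a) by rewrite ler_peMl ?sqn_ge0.
have comb (p x y z t : R) : x <= 2 * z + 2 * y -> y <= p * t -> z <= p * z ->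
  x <= 2 * p * (z + t) by nra.
exact: comb S2 IH pF.
Qed.

(** The crude constant is enough for its purpose, which is that the supremum in
    the definition of [opnorm] is finite. *)
Let frob2_mul_le m n p (X : 'M[R[i]]_(m, n)) (Y : 'M[R[i]]_(n, p)) :
  frob2 (X *m Y) <= 2 ^+ n * (frob2 X * frob2 Y).
Proof.
have le1 i k : sqn ((X *m Y) i k) <= 2 ^+ n * \sum_j (sqn (X i j) * sqn (Y j k)).
  rewrite mxE; apply: le_trans (sqn_sum_le _ _) _.
  have -> : size (index_enum (ordinal n : finType)) = n.
    by rewrite -sum1_size sum1_card card_ord.
  rewrite ler_wpM2l ?exprn_ge0//.
  by apply: ler_sum => j _; rewrite sqnM.
have le2 i j k : sqn (X i j) * sqn (Y j k) <= sqn (X i j) * \sum_j sqn (Y j k).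
  rewrite ler_wpM2l ?sqn_ge0// (bigD1 j)//= lerDl.
  by apply: sumr_ge0 => ? _; exact: sqn_ge0.
rewrite /frob2 mulr_suml mulr_sumr; apply: ler_sum => i _.
apply: le_trans (ler_sum _ (fun k _ => le1 i k)) _.
rewrite -mulr_sumr ler_wpM2l ?exprn_ge0//.
apply: le_trans (ler_sum _ (fun k _ => ler_sum _ (fun j _ => le2 i j k))) _.
rewrite exchange_big /= mulr_suml; apply: ler_sum => j _.
by rewrite -mulr_sumr ler_wpM2l ?sqn_ge0// [leLHS]exchange_big.
Qed.

Variable n : nat.
Implicit Types A : 'M[R[i]]_n.

Let opset A := [set l2norm (A *m v) | v in [set v : 'cV[R[i]]_n | l2norm v <= 1]].

Let opset_sup A : has_sup (opset A).
Proof.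
split.
  exists (l2norm (A *m 0)); exists 0 => //=.
  by rewrite l2normE frob20 sqrtr0 ler01.
exists (Num.sqrt (2 ^+ n * frob2 A)) => _ [v /= v1 <-].
rewrite l2normE ler_wsqrtr//; apply: le_trans (frob2_mul_le _ _) _.
rewrite ler_wpM2l ?exprn_ge0// ler_piMr ?frob2_ge0// -sqr_l2norm.
by rewrite exprn_ile1 ?l2norm_ge0.
Qed.

Lemma opnorm_ge0 A : 0 <= opnorm A.
Proof.
apply: le_trans (l2norm_ge0 (A *m 0)) _.
apply: ub_le_sup; first by case: (opset_sup A).
by exists 0 => //=; rewrite l2normE frob20 sqrtr0 ler01.
Qed.

Lemma l2norm_mulmx A v : l2norm (A *m v) <= opnorm A * l2norm v.
Proof.
have [v0|v0] := eqVneq (l2norm v) 0.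
  by rewrite (l2norm_eq0 v0) mulmx0 l2normE frob20 sqrtr0 mulr_ge0 ?opnorm_ge0// l2norm_ge0.
have v_gt0 : 0 < l2norm v by rewrite lt_neqAle eq_sym v0 l2norm_ge0.
rewrite -ler_pdivrMr// mulrC -l2normZ ?invr_ge0 ?l2norm_ge0//.
rewrite scalemxAr; apply: ub_le_sup; first by case: (opset_sup A).
exists ((l2norm v)^-1%:C *: v) => //=.
by rewrite l2normZ ?invr_ge0 ?l2norm_ge0// mulVf.
Qed.

Lemma opnorm_le A r : 0 <= r ->
  (forall v, l2norm (A *m v) <= r * l2norm v) -> opnorm A <= r.
Proof.
move=> r0 Ar; apply: ge_sup; first by case: (opset_sup A).
move=> _ [v /= v1 <-]; apply: le_trans (Ar v) _.
by rewrite ler_piMr.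
Qed.

Lemma frob2_mulmx_le A m (X : 'M[R[i]]_(n, m)) :
  frob2 (A *m X) <= opnorm A ^+ 2 * frob2 X.
Proof.
have frob2_col p q (Y : 'M[R[i]]_(p, q)) : frob2 Y = \sum_j frob2 (col j Y).
  rewrite /frob2 exchange_big; apply: eq_bigr => j _; apply: eq_bigr => i _.
  by rewrite big_ord_recl big_ord0 addr0 mxE.
rewrite frob2_col (frob2_col _ _ X) mulr_sumr; apply: ler_sum => j _.
have -> : col j (A *m X) = A *m col j X by rewrite !colE mulmxA.
rewrite -!sqr_l2norm -exprMn.
by rewrite ler_pXn2r ?nnegrE ?l2norm_ge0 ?mulr_ge0 ?opnorm_ge0 ?l2norm_ge0 ?l2norm_mulmx.
Qed.

Lemma sqn_le_opnorm A i j : sqn (A i j) <= opnorm A ^+ 2.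
Proof.
have := frob2_mulmx_le A (delta_mx j 0 : 'cV[R[i]]_n); rewrite frob2_delta mulr1.
apply: le_trans; rewrite -colE /frob2 (bigD1 i)//= big_ord_recl big_ord0 mxE addr0.
by rewrite lerDl sumr_ge0// => k _; apply: sumr_ge0 => l _; exact: sqn_ge0.
Qed.

Lemma frob2_le_opnorm A : frob2 A <= n%:R ^+ 2 * opnorm A ^+ 2.
Proof.
apply: (@le_trans _ _ (\sum_(i < n) \sum_(j < n) opnorm A ^+ 2)).
  by apply: ler_sum => i _; apply: ler_sum => j _; exact: sqn_le_opnorm.
by rewrite !sumr_const !card_ord -mulrnA -[leLHS]mulr_natl natrM.
Qed.

End operator_norm.

Section spectral_norm.
Context {R : realType} {n : nat}.
Implicit Types A : 'M[R[i]]_n.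

Lemma frob2_mul_diag m (X : 'M[R[i]]_(m, n)) (d : 'rV[R[i]]_n) (r : R) :
  (forall i, sqn (d 0 i) <= r) -> frob2 (X *m diag_mx d) <= r * frob2 X.
Proof.
move=> dr; rewrite /frob2 mulr_sumr; apply: ler_sum => i _.
rewrite mulr_sumr; apply: ler_sum => j _.
by rewrite mul_mx_diag mxE sqnM mulrC ler_wpM2r ?sqn_ge0.
Qed.

(** [A] acts on each vector, in an orthonormal eigenbasis, as a diagonal
    matrix. *)
Lemma opnorm_le_eig A (r : R) : A \is hermsymmx -> 0 <= r ->
  (forall i, `|eig A i| <= r) -> opnorm A <= r.
Proof.
move=> hA r0 Ar; apply: opnorm_le => // v.
rewrite -(ler_pXn2r (isT : (0 < 2)%N)) ?nnegrE ?mulr_ge0 ?l2norm_ge0//.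
rewrite exprMn !sqr_l2norm -frob2_trC -(frob2_trC v) trmx_mul map_mxM.
rewrite (hermP _ hA) -{1}(specfun_id hA) specfunE !mulmxA.
rewrite frob2_unitary ?spectral_unitarymx//.
rewrite -(@frob2_unitary _ _ _ _ ((spectralmx A) ^t*) (v ^t*)); last first.
  by rewrite trmxC_unitary spectral_unitarymx.
apply: frob2_mul_diag => i.
rewrite mxE (eigE i hA) /sqn /= expr0n addr0 -[leLHS]real_normK ?num_real//.
by rewrite ler_pXn2r ?nnegrE.
Qed.

Lemma eig_le_opnorm A i : A \is hermsymmx -> `|eig A i| <= opnorm A.
Proof.
move=> hA; set u := (row i (spectralmx A)) ^t*.
have u1 : frob2 u = 1.
  by rewrite frob2_trC rowE frob2_unitary ?frob2_delta// spectral_unitarymx.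
have Au : A *m u = (eig A i)%:C *: u.
  by have := specfun_eigenvector id A i; rewrite (specfun_id hA) (eigE i hA).
have := frob2_mulmx_le A u; rewrite Au frob2Z u1 !mulr1 -[leLHS]real_normK ?num_real//.
by rewrite ler_pXn2r ?nnegrE ?opnorm_ge0.
Qed.

Hypothesis n_gt0 : (0 < n)%N.

Lemma opnorm_attained A : A \is hermsymmx -> exists i, opnorm A = `|eig A i|.
Proof.
move=> hA; pose i0 := Ordinal n_gt0.
have [i _ imax] := @Order.TotalTheory.arg_maxP _ _ _ i0 xpredT (fun i => `|eig A i|) isT.
exists i; apply/eqP; rewrite eq_le eig_le_opnorm// andbT.
by apply: opnorm_le_eig => // j; exact: imax.
Qed.

Lemma cosh_opnorm A : A \is hermsymmx ->
  cosh (2 * opnorm A) <= complex.Re (\tr (mxfun (fun x => cosh (2 * x)) A)).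
Proof.
move=> hA; rewrite tr_mxfun; have [i ->] := opnorm_attained hA.
rewrite (bigD1 i)//= -[2 in leLHS]ger0_norm// -normrM cosh_norm lerDl.
by apply: sumr_ge0 => j _; exact: cosh_ge0.
Qed.

Lemma mxfunX A k : A \is hermsymmx -> A ^+ k = mxfun (fun x => x ^+ k) A.
Proof.
move=> hA; elim: k => [|k IH]; first by rewrite expr0 mxfun1.
rewrite exprS IH -[LHS]/(_ *m _) -{1}(mxfun_id hA) mxfunM.
by apply: eq_mxfun => x; rewrite exprS.
Qed.

(** The operator norm is the limit of the Schatten norms of order [2 k]; their
    powers are polynomials in the entries, which gives the measurability of the
    operator norm. *)
Lemma ge_opnorm_powerP A (s : R) : A \is hermsymmx -> 0 <= s ->
  s <= opnorm A <-> forall k, s ^+ (2 * k) <= complex.Re (\tr (A ^+ (2 * k))).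
Proof.
move=> hA s0; split=> [sA k|sA].
  rewrite mxfunX// tr_mxfun; have [i Ai] := opnorm_attained hA.
  rewrite (bigD1 i)//= exprM [in leRHS]exprM -[eig A i ^+ 2]real_normK ?num_real//.
  rewrite -Ai -exprM -[in leRHS]exprM.
  apply: (@le_trans _ _ (opnorm A ^+ (2 * k))).
    by rewrite lerXn2r ?nnegrE ?opnorm_ge0.
  rewrite lerDl; apply: sumr_ge0 => j _.
  by rewrite exprM exprn_ge0// sqr_ge0.
rewrite leNgt; apply/negP => As.
have s_gt0 : 0 < s := le_lt_trans (opnorm_ge0 A) As.
pose q := opnorm A / s.
have q0 : 0 <= q by rewrite divr_ge0 ?opnorm_ge0.
have q1 : q < 1 by rewrite ltr_pdivrMr// mul1r.
have qk k : 1 <= n%:R * q ^+ (2 * k).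
  have {sA} := sA k; rewrite mxfunX// tr_mxfun => sA.
  rewrite expr_div_n mulrA ler_pdivlMr ?exprn_gt0// mul1r; apply: le_trans sA _.
  apply: (@le_trans _ _ (\sum_(i < n) opnorm A ^+ (2 * k))); last first.
    by rewrite sumr_const card_ord mulr_natl.
  apply: ler_sum => i _.
  rewrite exprM -[eig A i ^+ 2]real_normK ?num_real// -exprM.
  by rewrite lerXn2r ?nnegrE ?opnorm_ge0// eig_le_opnorm.
have q2 : `|q ^+ 2| < 1 by rewrite ger0_norm ?sqr_ge0// expr_lt1.
have nV : 0 < n%:R^-1 :> R by rewrite invr_gt0 ltr0n.
have /cvgrPdist_lt /(_ _ nV)[k _ /(_ k (leqnn k))] := cvg_expr q2.
rewrite sub0r normrN ger0_norm ?exprn_ge0 ?sqr_ge0// -exprM ltNge.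
by rewrite -[leLHS]mulr1 ler_pdivrMl ?ltr0n// qk.
Qed.

End spectral_norm.

Section holder.
Context {R : realType} {n : nat}.

(** Cyclicity turns the trace into the inner product of [C] with [M *m C], to
    which the arithmetic-geometric mean inequality with weights [s] and [1 / s]
    applies. *)
Lemma rtr_mul_sq_le (M C : 'M[R[i]]_n) (s : R) : C \is hermsymmx -> 0 < s ->
  opnorm M <= s -> `|complex.Re (\tr (M *m (C *m C)))| <= s * frob2 C.
Proof.
move=> /hermP hC s0 Ms; rewrite mulmxA mxtrace_mulC.
have -> : \tr (C *m (M *m C)) = \tr (C ^t* *m (M *m C)) by rewrite hC.
have fMC : frob2 (M *m C) <= s ^+ 2 * frob2 C.
  apply: le_trans (frob2_mulmx_le _ _) _; rewrite ler_wpM2r ?frob2_ge0//.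
  by rewrite ler_pXn2r ?nnegrE ?opnorm_ge0// ltW.
suff : `|complex.Re (\tr (C ^t* *m (M *m C)))| <= (s * frob2 C + s^-1 * frob2 (M *m C)) / 2.
  move=> /le_trans; apply; rewrite ler_pdivrMr// [leRHS]mulr_natr mulr2n lerD2l.
  by rewrite ler_pdivrMl// mulrA -expr2.
move: (M *m C) => Y.
have term (x y : R[i]) : `|complex.Re ((x^*)%R * y)| <= (s * sqn x + s^-1 * sqn y) / 2.
  rewrite cReJM /sqn.
  have amgm (u v : R) : `|u * v| <= (s * u ^+ 2 + s^-1 * v ^+ 2) / 2.
    rewrite normrM -[u ^+ 2]real_normK ?num_real// -[v ^+ 2]real_normK ?num_real//.
    move: `|u| `|v| => {}u {}v.
    have -> : (s * u ^+ 2 + s^-1 * v ^+ 2) / 2 = u * v + s^-1 * (s * u - v) ^+ 2 / 2.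
      by field; rewrite gt_eqF.
    by rewrite lerDl divr_ge0// mulr_ge0 ?invr_ge0 ?sqr_ge0// ltW.
  apply: le_trans (ler_normD _ _) _.
  by apply: le_trans (lerD (amgm _ _) (amgm _ _)) _;
    rewrite le_eqVlt; apply/orP; left; apply/eqP; ring.
rewrite /mxtrace cRe_sum; apply: le_trans (ler_norm_sum _ _ _) _.
rewrite /frob2 [X in s * X]exchange_big [X in s^-1 * X]exchange_big /=.
rewrite !mulr_sumr -big_split mulr_suml /=; apply: ler_sum => i _.
rewrite mxE cRe_sum; apply: le_trans (ler_norm_sum _ _ _) _.
rewrite !mulr_sumr -big_split mulr_suml /=; apply: ler_sum => j _.
by rewrite adjE term.
Qed.

End holder.

(** * Measurable and square integrable matrices *)

Section measurable_matrices.
Context d (T : measurableType d) {R : realType} {n : nat}.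
Implicit Types F G : T -> 'M[R[i]]_n.

Lemma mx_measurable_cst (M : 'M[R[i]]_n) : mx_measurable (fun _ : T => M).
Proof. by move=> i j; split; exact: measurable_cst. Qed.

Lemma mx_measurableD F G : mx_measurable F -> mx_measurable G ->
  mx_measurable (fun x => F x + G x).
Proof.
move=> mF mG i j; have [rF iF] := mF i j; have [rG iG] := mG i j.
split; under eq_fun do rewrite mxE ?cReD ?cImD; exact: measurable_funD.
Qed.

Lemma mx_measurableZ (c : R) F : mx_measurable F ->
  mx_measurable (fun x => c%:C *: F x).
Proof.
move=> mF i j; have [rF iF] := mF i j.
split; under eq_fun do rewrite mxE ?cReRM ?cImRM; exact: measurable_funM.
Qed.

Lemma mx_measurableB F G : mx_measurable F -> mx_measurable G ->
  mx_measurable (fun x => F x - G x).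
Proof.
move=> mF mG i j; have [rF iF] := mF i j; have [rG iG] := mG i j.
split; under eq_fun do rewrite !mxE ?cReD ?cImD ?cReN ?cImN; exact: measurable_funB.
Qed.

Lemma mx_measurableM F G : mx_measurable F -> mx_measurable G ->
  mx_measurable (fun x => F x *m G x).
Proof.
move=> mF mG i j; split; under eq_fun do rewrite mxE ?cRe_sum ?cIm_sum;
  apply: measurable_sum => k; have [rF iF] := mF i k; have [rG iG] := mG k j.
- under eq_fun do rewrite cReM.
  by apply: measurable_funB; exact: measurable_funM.
- under eq_fun do rewrite cImM.
  by apply: measurable_funD; exact: measurable_funM.
Qed.

Lemma mx_measurable_comp d' (T' : measurableType d') (phi : T' -> T) F :
  measurable_fun setT phi -> mx_measurable F -> mx_measurable (F \o phi).
Proof.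
move=> mphi mF i j; have [rF iF] := mF i j.
by split; [exact: (measurableT_comp rF mphi)|exact: (measurableT_comp iF mphi)].
Qed.

Lemma measurable_rtr F : mx_measurable F ->
  measurable_fun setT (fun x => complex.Re (\tr (F x))).
Proof.
move=> mF; under eq_fun do rewrite /mxtrace cRe_sum.
by apply: measurable_sum => i; have [] := mF i i.
Qed.

Lemma measurable_sqn F i j : mx_measurable F ->
  measurable_fun setT (fun x => sqn (F x i j)).
Proof.
by move=> mF; have [rF iF] := mF i j; apply: measurable_funD; exact: measurable_funX.
Qed.

Lemma measurable_frob2 F : mx_measurable F ->
  measurable_fun setT (fun x => frob2 (F x)).
Proof.
move=> mF; rewrite /frob2; apply: measurable_sum => i; apply: measurable_sum => j.
exact: measurable_sqn.
Qed.

(** A singleton is measurable, so that a function of [Z 0] that is equal to its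
    value at [z] almost surely can be replaced by this value. *)
Lemma measurable_mx_eq F M : mx_measurable F -> measurable [set x | F x = M].
Proof.
move=> mF; pose S i j := [set x | complex.Re (F x i j) = complex.Re (M i j)] `&`
   [set x | complex.Im (F x i j) = complex.Im (M i j)].
have -> : [set x | F x = M] = \bigcap_(p in [set: 'I_n * 'I_n]) S p.1 p.2.
  apply/seteqP; split=> x /=; first by move=> FM [i j] _; rewrite /S /= FM.
  move=> H; apply/matrixP => i j; have [/= re im] := H (i, j) Logic.I.
  by apply/eqP; rewrite eq_complex re im !eqxx.
apply: fin_bigcap_measurable => // -[i j] _; have [rF iF] := mF i j.
have meq (u : T -> R) (a : R) : measurable_fun setT u -> measurable [set x | u x = a].
  by move=> mu; rewrite -[X in measurable X]setTI;
    exact: (mu measurableT [set a] (measurable_set1 a)).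
by apply: measurableI; exact: meq.
Qed.

Lemma sqn_le_frob2 (X : 'M[R[i]]_n) i j : sqn (X i j) <= frob2 X.
Proof.
rewrite /frob2 (bigD1 i)//= (bigD1 j)//= -addrA lerDl addr_ge0//.
  by apply: sumr_ge0 => k _; exact: sqn_ge0.
by apply: sumr_ge0 => k _; apply: sumr_ge0 => l _; exact: sqn_ge0.
Qed.

Lemma sqr_Re_le_frob2 (X : 'M[R[i]]_n) i j : complex.Re (X i j) ^+ 2 <= frob2 X.
Proof. by apply: le_trans (sqn_le_frob2 X i j); rewrite lerDl sqr_ge0. Qed.

Lemma sqr_Im_le_frob2 (X : 'M[R[i]]_n) i j : complex.Im (X i j) ^+ 2 <= frob2 X.
Proof. by apply: le_trans (sqn_le_frob2 X i j); rewrite lerDr sqr_ge0. Qed.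

End measurable_matrices.

Section square_integrable.
Context d (T : measurableType d) {R : realType} {n : nat}.
Variable m : {measure set T -> \bar R}.
Implicit Types F G : T -> 'M[R[i]]_n.

Definition frob_finite F := (\int[m]_x (frob2 (F x))%:E < +oo)%E.

Lemma mx_sqintegrable_frob F : mx_sqintegrable m F -> mx_measurable F /\ frob_finite F.
Proof.
move=> [mF F2]; split=> //.
have mo : measurable_fun setT (fun x => (frob2 (F x))%:E).
  by apply/measurable_EFinP; exact: measurable_frob2.
have n2 : 0 <= (n.+1%:R ^- 2 : R) by rewrite invr_ge0 exprn_ge0.
have : (\int[m]_x ((n.+1%:R ^- 2)%:E * (frob2 (F x))%:E) < +oo)%E.
  apply: le_lt_trans F2; apply: ge0_le_integralT => x.
    by rewrite -EFinM lee_fin mulr_ge0 ?frob2_ge0.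
  rewrite -EFinM lee_fin ler_pdivrMl ?exprn_gt0//.
  apply: le_trans (frob2_le_opnorm _) _.
  by rewrite ler_wpM2r ?sqr_ge0// lerXn2r ?nnegrE ?ler_nat.
rewrite ge0_integralZl//; last by move=> x _; rewrite lee_fin frob2_ge0.
rewrite /frob_finite; move: (integral _ _ _) => I.
case: I => [r _|h|_]; [exact: ltry| |by []].
by move: h; rewrite gt0_muley// lte_fin invr_gt0 exprn_gt0.
Qed.

Lemma frob_finite_Re F i j : frob_finite F -> (\int[m]_x (complex.Re (F x i j) ^+ 2)%:E < +oo)%E.
Proof.
move=> F2; apply: le_lt_trans F2; apply: ge0_le_integralT => x.
  by rewrite lee_fin sqr_ge0.
by rewrite lee_fin sqr_Re_le_frob2.
Qed.

Lemma frob_finite_Im F i j : frob_finite F -> (\int[m]_x (complex.Im (F x i j) ^+ 2)%:E < +oo)%E.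
Proof.
move=> F2; apply: le_lt_trans F2; apply: ge0_le_integralT => x.
  by rewrite lee_fin sqr_ge0.
by rewrite lee_fin sqr_Im_le_frob2.
Qed.

Lemma frob2D_le (X Y : 'M[R[i]]_n) : frob2 (X - Y) <= 2 * frob2 X + 2 * frob2 Y.
Proof.
rewrite /frob2 !mulr_sumr -big_split /=; apply: ler_sum => i _.
rewrite !mulr_sumr -big_split /=; apply: ler_sum => j _.
rewrite !mxE /sqn !cReD !cImD !cReN !cImN.
move: (complex.Re _) (complex.Im _) (complex.Re _) (complex.Im _) => a b c e.
by have := sqr_ge0 (a + c); have := sqr_ge0 (b + e); nra.
Qed.

Lemma integrable_rtr_mulr (F : T -> 'M[R[i]]_n) (S : 'M[R[i]]_n) :
  (forall i j, m.-integrable setT (fun x => (complex.Re (F x i j))%:E)) ->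
  (forall i j, m.-integrable setT (fun x => (complex.Im (F x i j))%:E)) ->
  m.-integrable setT (fun x => (complex.Re (\tr (F x *m S)))%:E) /\
  \int[m]_x complex.Re (\tr (F x *m S)) = complex.Re (\tr (mexp m F *m S)).
Proof.
move=> reF imF.
have trE (X : 'M[R[i]]_n) : complex.Re (\tr (X *m S)) =
    \sum_(p : 'I_n * 'I_n) (complex.Re (S p.2 p.1) * complex.Re (X p.1 p.2) +
      - complex.Im (S p.2 p.1) * complex.Im (X p.1 p.2)).
  rewrite -(pair_bigA _ (fun i j => complex.Re (S j i) * complex.Re (X i j) +
      - complex.Im (S j i) * complex.Im (X i j))) /=.
  rewrite /mxtrace cRe_sum; apply: eq_bigr => i _.
  rewrite mxE cRe_sum; apply: eq_bigr => j _.
  by rewrite cReM mulNr; congr (_ - _); exact: mulrC.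
pose t (p : 'I_n * 'I_n) x := complex.Re (S p.2 p.1) * complex.Re (F x p.1 p.2) +
      - complex.Im (S p.2 p.1) * complex.Im (F x p.1 p.2).
have iRe p := integrableZl measurableT (complex.Re (S p.2 p.1)) (reF p.1 p.2).
have iIm p := integrableZl measurableT (- complex.Im (S p.2 p.1)) (imF p.1 p.2).
have ti p : m.-integrable setT (EFin \o t p) := integrableD measurableT (iRe p) (iIm p).
have sumI (s : seq ('I_n * 'I_n)) :
    m.-integrable setT (EFin \o (fun x => \sum_(p <- s) t p x)) /\
    \int[m]_x (\sum_(p <- s) t p x) = \sum_(p <- s) \int[m]_x t p x.
  elim: s => [|p s [IH1 IH2]].
    under eq_fun do rewrite big_nil; rewrite big_nil; split.
      by apply: eq_integrable (integrable0 m setT).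
    by rewrite /Rintegral integral0.
  under eq_fun do rewrite big_cons; rewrite big_cons -IH2; split.
    by apply: eq_integrable (integrableD _ (ti p) IH1).
  by rewrite RintegralD.
have [s1 s2] := sumI (index_enum _).
split; first by under eq_fun do rewrite trE; exact: s1.
transitivity (\int[m]_x (\sum_p t p x)).
  by apply: eq_Rintegral => x _; exact: trE.
apply: (etrans s2); rewrite trE; apply: eq_bigr => p _; rewrite /t RintegralD//; last 2 first.
- exact: iRe.
- exact: iIm.
rewrite (RintegralZl (f := fun x => complex.Re (F x p.1 p.2)) _ measurableT (reF _ _)).
rewrite (RintegralZl (f := fun x => complex.Im (F x p.1 p.2)) _ measurableT (imF _ _)).
by rewrite mxE.
Qed.

End square_integrable.

(** * The matrix variance *)

Section square_entries.
Context {R : realType} {n : nat}.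
Implicit Type X : 'M[R[i]]_n.

(** The squared norm dominates all entries of the square, so that its finite
    mean makes the expected square a genuine expectation. *)
Lemma sq_entry_le X i j :
  `|complex.Re ((X ^+ 2) i j)| <= frob2 X /\ `|complex.Im ((X ^+ 2) i j)| <= frob2 X.
Proof.
have amgm (a b c e : R) : `|a * b + c * e| <= (a ^+ 2 + c ^+ 2 + (b ^+ 2 + e ^+ 2)) / 2.
  rewrite ler_norml; apply/andP; split.
    by have := sqr_ge0 (a + b); have := sqr_ge0 (c + e); nra.
  by have := sqr_ge0 (a - b); have := sqr_ge0 (c - e); nra.
have re (x y : R[i]) : `|complex.Re (x * y)| <= (sqn x + sqn y) / 2.
  by rewrite cReM -mulNr; apply: le_trans (amgm _ _ _ _) _; rewrite sqrrN.
have im (x y : R[i]) : `|complex.Im (x * y)| <= (sqn x + sqn y) / 2.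
  rewrite cImM; apply: le_trans (amgm _ _ _ _) _.
  by rewrite [complex.Im y ^+ 2 + _]addrC.
have row : \sum_k sqn (X i k) <= frob2 X.
  rewrite /frob2 [leRHS](bigD1 i)//= lerDl; apply: sumr_ge0 => k _.
  by apply: sumr_ge0 => l _; exact: sqn_ge0.
have col : \sum_k sqn (X k j) <= frob2 X.
  have le k : sqn (X k j) <= \sum_l sqn (X k l).
    by rewrite (bigD1 j)//= lerDl; apply: sumr_ge0 => l _; exact: sqn_ge0.
  by apply: ler_sum => k _; exact: le.
have key : \sum_k (sqn (X i k) + sqn (X k j)) / 2 <= frob2 X.
  by rewrite -mulr_suml big_split /= ler_pdivrMr// mulr_natr mulr2n lerD.
split; rewrite expr2 -[X * X]/(X *m X) mxE ?cRe_sum ?cIm_sum;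
  by apply: le_trans (le_trans (ler_norm_sum _ _ _) (ler_sum _ (fun k _ => _ k _))) key.
Qed.

Lemma herm_sq_diag X i : X \is hermsymmx ->
  complex.Re ((X ^+ 2) i i) = \sum_k sqn (X i k).
Proof.
move=> /hermP hX; rewrite expr2 -[X * X]/(X *m X) mxE cRe_sum.
by apply: eq_bigr => k _; rewrite -{2}hX adjE mulcJ.
Qed.

Lemma herm_rtr_sq X : X \is hermsymmx -> complex.Re (\tr (X ^+ 2)) = frob2 X.
Proof.
move=> hX; rewrite /mxtrace cRe_sum /frob2; apply: eq_bigr => i _.
exact: herm_sq_diag.
Qed.

End square_entries.

Section expected_square.
Context d (T : measurableType d) {R : realType} {n : nat}.
Variable m : {measure set T -> \bar R}.
Implicit Types F X : T -> 'M[R[i]]_n.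

Lemma mx_measurable_sq X : mx_measurable X -> mx_measurable (fun x => X x ^+ 2).
Proof. by move=> mX; exact: mx_measurableM. Qed.

Lemma integrable_sq_entries X : mx_measurable X -> frob_finite m X -> forall i j,
  m.-integrable setT (fun x => (complex.Re ((X x ^+ 2) i j))%:E) /\
  m.-integrable setT (fun x => (complex.Im ((X x ^+ 2) i j))%:E).
Proof.
move=> mX X2 i j; have [rX iX] := mx_measurable_sq mX i j.
by split; apply/integrableP; split; (try exact/measurable_EFinP);
  apply: le_lt_trans X2; apply: ge0_le_integralT => x //=; rewrite lee_fin;
  have [] := sq_entry_le (X x) i j.
Qed.

Lemma rtr_mexp_sq_mulr X (S : 'M[R[i]]_n) : mx_measurable X -> frob_finite m X ->
  complex.Re (\tr (mexp m (fun x => X x ^+ 2) *m S)) =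
  \int[m]_x complex.Re (\tr (X x ^+ 2 *m S)) /\
  m.-integrable setT (fun x => (complex.Re (\tr (X x ^+ 2 *m S)))%:E).
Proof.
move=> mX X2; have [] := @integrable_rtr_mulr _ _ _ _ m (fun x => X x ^+ 2) S.
- by move=> i j; have [] := integrable_sq_entries mX X2 i j.
- by move=> i j; have [] := integrable_sq_entries mX X2 i j.
by move=> ? ->.
Qed.

Lemma rtr_mexp_sq X : (forall x, X x \is hermsymmx) -> mx_measurable X ->
  frob_finite m X ->
  (\int[m]_x (frob2 (X x))%:E =
   (complex.Re (\tr (mexp m (fun x => X x ^+ 2))))%:E)%E.
Proof.
move=> hX mX X2; rewrite -[mexp _ _]mulmx1.
have [-> _] := rtr_mexp_sq_mulr 1%:M mX X2.
rewrite -Rintegral_EFin; last by have [] := rtr_mexp_sq_mulr 1%:M mX X2.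
by apply: eq_integral => x _; rewrite mulmx1 herm_rtr_sq.
Qed.

End expected_square.

Section matrix_variance.
Context d (T : measurableType d) {R : realType} {n : nat}.
Variable mu : probability T R.
Implicit Types F : T -> 'M[R[i]]_n.

Let pint (f : T -> R) : measurable_fun setT f ->
  (\int[mu]_x (f x ^+ 2)%:E < +oo)%E -> mu.-integrable setT (EFin \o f).
Proof. by move=> mf f2; apply: integrable_of_sq => //; exact: probability_setT. Qed.

Lemma mexp_herm F : (forall x, F x \is hermsymmx) -> mx_measurable F ->
  frob_finite mu F -> mexp mu F \is hermsymmx.
Proof.
move=> hF mF F2; apply/hermP/matrixP => i j; rewrite adjE.
have Fji x : F x i j = ((F x j i)^*)%R by rewrite -adjE (hermP _ (hF x)).
rewrite !mxE; apply/eqP; rewrite eq_complex cReJ cImJ /=; apply/andP; split; apply/eqP.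
  by apply: eq_Rintegral => x _; rewrite Fji cReJ.
have iF : mu.-integrable setT (EFin \o (fun x => complex.Im (F x j i))).
  by apply: pint; [have [] := mF j i|exact: frob_finite_Im].
rewrite -mulN1r -(RintegralZl (-1) measurableT iF).
by apply: eq_Rintegral => x _; rewrite Fji cImJ mulN1r.
Qed.

Lemma frob_finite_subr F (M : 'M[R[i]]_n) : mx_measurable F -> frob_finite mu F ->
  frob_finite mu (fun x => F x - M).
Proof.
move=> mF F2; rewrite /frob_finite.
have mF2 : measurable_fun setT (fun x => (frob2 (F x))%:E).
  by apply/measurable_EFinP; exact: measurable_frob2.
apply: (@le_lt_trans _ _ (\int[mu]_x (2%:E * (frob2 (F x))%:E + (2 * frob2 M)%:E))%E).
  apply: ge0_le_integralT => x; first by rewrite lee_fin frob2_ge0.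
  by rewrite -EFinM -EFinD lee_fin frob2D_le.
rewrite ge0_integralD//; last 3 first.
- by move=> x _; rewrite -EFinM lee_fin mulr_ge0 ?frob2_ge0.
- exact: measurable_funeM.
- by move=> x _; rewrite lee_fin mulr_ge0 ?frob2_ge0.
rewrite probability_integral_cst ge0_integralZl//; last first.
  by move=> x _; rewrite lee_fin frob2_ge0.
by rewrite lte_add_pinfty ?ltry// lte_mul_pinfty.
Qed.

(** The centred matrix is Hermitian, so that the trace of its square is the sum
    of the squared moduli of its entries. This reduces the matrix variance to
    scalar variances. *)
Lemma rtr_mvar_rvar F : (forall x, F x \is hermsymmx) -> mx_measurable F ->
  frob_finite mu F -> complex.Re (\tr (mvar mu F)) =
  \sum_i \sum_j (rvar mu (fun x => complex.Re (F x i j)) +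
                 rvar mu (fun x => complex.Im (F x i j))).
Proof.
move=> hF mF F2; set M := mexp mu F.
have hM : M \is hermsymmx by exact: mexp_herm.
have mFM : mx_measurable (fun x => F x - M).
  by apply: mx_measurableB => //; exact: mx_measurable_cst.
have FM2 : frob_finite mu (fun x => F x - M) by exact: frob_finite_subr.
have hFM x : F x - M \is hermsymmx by exact: hermB.
have sq0 (f : T -> R) x : (0 <= (f x ^+ 2)%:E)%E by rewrite lee_fin sqr_ge0.
have msq (f : T -> R) : measurable_fun setT f -> measurable_fun setT (fun x => (f x ^+ 2)%:E).
  by move=> mf; exact/measurable_EFinP/measurable_funX.
have reM x i j : complex.Re ((F x - M) i j) =
    complex.Re (F x i j) - \int[mu]_y complex.Re (F y i j).
  by rewrite !mxE cReD cReN.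
have imM x i j : complex.Im ((F x - M) i j) =
    complex.Im (F x i j) - \int[mu]_y complex.Im (F y i j).
  by rewrite !mxE cImD cImN.
apply: EFin_inj; rewrite -(rtr_mexp_sq hFM mFM FM2).
under eq_integral do rewrite /frob2 -sumEFin.
rewrite ge0_integral_sum//; last 2 first.
- move=> i; apply/measurable_EFinP; apply: measurable_sum => j; exact: measurable_sqn.
- by move=> i x _; rewrite lee_fin sumr_ge0// => j _; exact: sqn_ge0.
rewrite -sumEFin; apply: eq_bigr => i _.
under eq_integral do rewrite -sumEFin.
rewrite ge0_integral_sum//; last 2 first.
- by move=> j; apply/measurable_EFinP; exact: measurable_sqn.
- by move=> j x _; rewrite lee_fin sqn_ge0.
rewrite -sumEFin; apply: eq_bigr => j _.
have [rFM iFM] := mFM i j.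
under eq_integral do rewrite /sqn EFinD.
rewrite ge0_integralD//; do ?[by move=> ? _; rewrite lee_fin sqr_ge0 | exact: msq].
rewrite EFinD; congr (_ + _)%E.
- rewrite (ge0_Rintegral_EFin (f := fun x => complex.Re ((F x - M) i j) ^+ 2)).
  + by congr EFin; apply: eq_Rintegral => x _; rewrite reM.
  + by move=> x; exact: sqr_ge0.
  + exact: (frob_finite_Re i j FM2).
- rewrite (ge0_Rintegral_EFin (f := fun x => complex.Im ((F x - M) i j) ^+ 2)).
  + by congr EFin; apply: eq_Rintegral => x _; rewrite imM.
  + by move=> x; exact: sqr_ge0.
  + exact: (frob_finite_Im i j FM2).
Qed.

End matrix_variance.

Section antisymmetric_matrices.
Context d (T : measurableType d) {R : realType} {n : nat}.
Variable mu : probability T R.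
Variable h : T * T -> 'M[R[i]]_n.
Hypothesis mh : mx_measurable h.
Hypothesis hh : forall p, h p \is hermsymmx.
Hypothesis hC : forall x y, h (y, x) = - h (x, y).
Hypothesis h1 : forall y, frob_finite mu (fun x => h (x, y)).
Hypothesis h2 : frob_finite (mu \x mu)%E h.

Let mh1 y : mx_measurable (fun x => h (x, y)).
Proof. by apply: (mx_measurable_comp (F := h)) => //; exact: measurable_fun_pair. Qed.

Let rk i j := fun p => complex.Re (h p i j).
Let ik i j := fun p => complex.Im (h p i j).

Let rtrE y : complex.Re (\tr (mvar mu (fun x => h (x, y)))) =
  \sum_i \sum_j (rvar mu (fun x => rk i j (x, y)) + rvar mu (fun x => ik i j (x, y))).
Proof. by rewrite rtr_mvar_rvar. Qed.

Let mrv i j : measurable_fun setT (fun y => rvar mu (fun x => rk i j (x, y))).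
Proof.
apply: measurable_rvar_section; first by have [] := mh i j.
- by move=> y; apply: (frob_finite_Re i j (h1 y)).
- exact: (frob_finite_Re i j h2).
Qed.

Let miv i j : measurable_fun setT (fun y => rvar mu (fun x => ik i j (x, y))).
Proof.
apply: measurable_rvar_section; first by have [] := mh i j.
- by move=> y; apply: (frob_finite_Im i j (h1 y)).
- exact: (frob_finite_Im i j h2).
Qed.

Lemma rtr_mvar_section_ge0 y : 0 <= complex.Re (\tr (mvar mu (fun x => h (x, y)))).
Proof.
rewrite rtrE; apply: sumr_ge0 => i _; apply: sumr_ge0 => j _.
by rewrite addr_ge0 ?rvar_ge0.
Qed.

(** The real and imaginary parts of each entry are antisymmetric functions, to
    which [antisym_variance] applies. *)
Lemma antisym_matrix_variance :
  (\int[mu \x mu]_p (frob2 (h p))%:E <=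
   2%:E * \int[mu]_y (complex.Re (\tr (mvar mu (fun x => h (x, y)))))%:E)%E.
Proof.
under [in leRHS]eq_integral do rewrite rtrE -sumEFin.
rewrite [in leRHS]ge0_integral_sum//; last 2 first.
- move=> i; apply/measurable_EFinP; apply: measurable_sum => j.
  exact: measurable_funD.
- move=> i y _; rewrite lee_fin; apply: sumr_ge0 => j _.
  by rewrite addr_ge0 ?rvar_ge0.
under [in leLHS]eq_integral do rewrite /frob2 -sumEFin.
rewrite [in leLHS]ge0_integral_sum//; last 2 first.
- move=> i; apply/measurable_EFinP; apply: measurable_sum => j.
  exact: measurable_sqn.
- by move=> i y _; rewrite lee_fin; apply: sumr_ge0 => j _; exact: sqn_ge0.
rewrite ge0_sume_distrr; last first.
  move=> i _; apply: integral_ge0 => y _; rewrite lee_fin.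
  by apply: sumr_ge0 => j _; rewrite addr_ge0 ?rvar_ge0.
apply: lee_sum => i _.
under [in leRHS]eq_integral do rewrite -sumEFin.
rewrite [in leRHS]ge0_integral_sum//; last 2 first.
- by move=> j; apply/measurable_EFinP; exact: measurable_funD.
- by move=> j y _; rewrite lee_fin addr_ge0 ?rvar_ge0.
under [in leLHS]eq_integral do rewrite -sumEFin.
rewrite [in leLHS]ge0_integral_sum//; last 2 first.
- by move=> j; apply/measurable_EFinP; exact: measurable_sqn.
- by move=> j y _; rewrite lee_fin sqn_ge0.
rewrite ge0_sume_distrr; last first.
  by move=> j _; apply: integral_ge0 => y _; rewrite lee_fin addr_ge0 ?rvar_ge0.
apply: lee_sum => j _.
under [in leRHS]eq_integral do rewrite EFinD.
rewrite [in leRHS]ge0_integralD//; last 4 first.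
- by move=> y _; rewrite lee_fin rvar_ge0.
- exact/measurable_EFinP.
- by move=> y _; rewrite lee_fin rvar_ge0.
- exact/measurable_EFinP.
have [rh ih] := mh i j.
under [in leLHS]eq_integral do rewrite /sqn EFinD.
rewrite [in leLHS]ge0_integralD//; last 4 first.
- by move=> y _; rewrite lee_fin sqr_ge0.
- exact/measurable_EFinP/measurable_funX.
- by move=> y _; rewrite lee_fin sqr_ge0.
- exact/measurable_EFinP/measurable_funX.
rewrite ge0_muleDr; last 2 first.
- by apply: integral_ge0 => y _; rewrite lee_fin rvar_ge0.
- by apply: integral_ge0 => y _; rewrite lee_fin rvar_ge0.
apply: leeD.
- apply: (@antisym_variance _ _ _ mu (rk i j)) => //.
  + by move=> x y; rewrite /rk hC mxE cReN.
  + by move=> y; apply: (frob_finite_Re i j (h1 y)).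
  + exact: (frob_finite_Re i j h2).
- apply: (@antisym_variance _ _ _ mu (ik i j)) => //.
  + by move=> x y; rewrite /ik hC mxE cImN.
  + by move=> y; apply: (frob_finite_Im i j (h1 y)).
  + exact: (frob_finite_Im i j h2).
Qed.

End antisymmetric_matrices.

(** * The Dirichlet form as a limit of energies *)

Section kernel_integrals.
Context d dW (T : measurableType d) (W : measurableType dW) {R : realType}.
Variables (P : R.-pker T ~> W) (mu : probability T R).
Local Notation nu := (path_law P mu).

Lemma measurable_kernel_integral (u : W -> \bar R) : (forall w, 0 <= u w)%E ->
  measurable_fun setT u -> measurable_fun setT (fun z => (\int[P z]_w u w)%E).
Proof.
move=> u0 um; apply: measurable_fun_integral_kernel => // U mU.
exact: measurable_kernel.
Qed.

Lemma measurable_kernel_Rintegral (u : W -> R) :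
  measurable_fun setT u -> measurable_fun setT (fun z => \int[P z]_w u w).
Proof.
move=> um; apply: (measurableT_comp (fine_measurable measurableT)).
have mu' : measurable_fun setT (EFin \o u) by exact/measurable_EFinP.
rewrite (_ : (fun z => _) = (fun z => \int[P z]_w ((EFin \o u)^\+ w) -
    \int[P z]_w ((EFin \o u)^\- w))%E); last first.
  by apply/funext => z; rewrite -integralE.
apply: emeasurable_funB; apply: measurable_kernel_integral => //.
- exact: measurable_funepos.
- exact: measurable_funeneg.
Qed.

Lemma ae_kernel_integral_finite (u : W -> R) : (forall w, 0 <= u w) -> measurable_fun setT u ->
  (\int[nu]_w (u w)%:E < +oo)%E ->
  {ae mu, forall z, (\int[P z]_w (u w)%:E < +oo)%E}.
Proof.
move=> u0 um fin.
have mu' : measurable_fun setT (fun w => (u w)%:E) by exact/measurable_EFinP.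
have I0 z : (0 <= \int[P z]_w (u w)%:E)%E by apply: integral_ge0 => w _; rewrite lee_fin.
have int : mu.-integrable setT (fun z => \int[P z]_w (u w)%:E)%E.
  apply/integrableP; split; first exact: measurable_kernel_integral.
  under eq_integral do rewrite gee0_abs//.
  by rewrite -ge0_integral_path_law// => w; rewrite lee_fin.
have := integrable_ae measurableT int; apply: filterS => z /(_ Logic.I).
by rewrite ge0_fin_numE.
Qed.

(** The real integral is 0 where the extended one is infinite; by Tonelli this
    happens only on a null set of initial states. *)
Lemma integral_kernel_Rintegral (u : W -> R) : (forall w, 0 <= u w) ->
  measurable_fun setT u -> (\int[nu]_w (u w)%:E < +oo)%E ->
  (\int[mu]_z (\int[P z]_w u w)%R%:E = \int[nu]_w (u w)%:E)%E.
Proof.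
move=> u0 um fin.
have mu' : measurable_fun setT (fun w => (u w)%:E) by exact/measurable_EFinP.
rewrite ge0_integral_path_law//.
apply: ge0_ae_eq_integral => //.
- exact/measurable_EFinP/measurable_kernel_Rintegral.
- by apply: measurable_kernel_integral => // w; rewrite lee_fin.
- by move=> z _; rewrite lee_fin; apply: Rintegral_ge0.
- by move=> z _; apply: integral_ge0 => w _; rewrite lee_fin.
have := ae_kernel_integral_finite u0 um fin; apply: filterS => z zfin _.
by rewrite (ge0_Rintegral_EFin u0 zfin).
Qed.

Lemma mx_measurable_kernel_mexp n (X : W -> 'M[R[i]]_n) : mx_measurable X ->
  mx_measurable (fun z => mexp (P z) X).
Proof.
move=> mX i j; have [rX iX] := mX i j.
by split; under eq_fun do rewrite mxE /=; exact: measurable_kernel_Rintegral.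
Qed.

End kernel_integrals.

Lemma norm_Re_le_opnorm (R : realType) n (M : 'M[R[i]]_n) i j :
  `|complex.Re (M i j)| <= opnorm M.
Proof.
rewrite -(ler_pXn2r (isT : (0 < 2)%N)) ?nnegrE ?opnorm_ge0//.
apply: le_trans (sqn_le_opnorm M i j); rewrite real_normK ?num_real//.
by rewrite lerDl sqr_ge0.
Qed.

Section dirichlet_limit.
Context d dW (T : measurableType d) (W : measurableType dW) {R : realType} {n : nat}.
Variables (Z : R -> W -> T) (P : R.-pker T ~> W) (mu : probability T R).
Hypothesis Z_markov : markov_process Z P.
Hypothesis Z_stationary : stationary Z P mu.
Local Notation nu := (path_law P mu).
Variable H : T -> 'M[R[i]]_n.
Hypothesis mH : mx_measurable H.

Let incr t w := H (Z t w) - H (Z 0 w).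

Let mHZ t : 0 <= t -> mx_measurable (fun w => H (Z t w)).
Proof. by move=> t0; apply: mx_measurable_comp => //; exact: (markov_measurable Z_markov). Qed.

Lemma mx_measurable_incr t : 0 <= t -> mx_measurable (incr t).
Proof. by move=> t0; apply: mx_measurableB; exact: mHZ. Qed.

Lemma mx_measurable_cdc_approx t : 0 <= t -> mx_measurable (cdc_approx Z P H t).
Proof.
move=> t0; apply: mx_measurableZ; apply: mx_measurable_kernel_mexp.
by apply: mx_measurable_sq; exact: mx_measurable_incr.
Qed.

Let u (k : nat) : R := k.+1%:R^-1.
Let u_gt0 k : 0 < u k. Proof. by rewrite invr_gt0. Qed.

(** The limit at 0 exists, so it can be taken along the sequence
    [1 / (k + 1)]. *)
Lemma mx_measurable_cdc : cdc_pointwise Z P H -> mx_measurable (cdc Z P H).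
Proof.
move=> cH i j.
have uc (f : R -> R) : cvg (f t @[t --> 0^'+]) ->
    f (u k) @[k --> \oo] --> lim (f t @[t --> 0^'+]).
  by move=> /cvg_at_rightP; apply; split=> //; exact: cvg_harmonic.
have mA k : mx_measurable (cdc_approx Z P H (u k)).
  by apply: mx_measurable_cdc_approx; exact: ltW.
split.
- apply: (measurable_fun_cvg (h := fun k z => complex.Re (cdc_approx Z P H (u k) z i j))).
    by move=> k; have [] := mA k i j.
  by move=> z _; rewrite mxE /=; have [_ /(_ i j)[c _]] := cH z; exact: (uc _ c).
- apply: (measurable_fun_cvg (h := fun k z => complex.Im (cdc_approx Z P H (u k) z i j))).
    by move=> k; have [] := mA k i j.
  by move=> z _; rewrite mxE /=; have [_ /(_ i j)[_ c]] := cH z; exact: (uc _ c).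
Qed.

Hypothesis H2 : frob_finite mu H.

(** By stationarity both ends of the increment have law [mu]. *)
Lemma frob_finite_incr t : 0 <= t -> frob_finite nu (incr t).
Proof.
move=> t0; rewrite /frob_finite.
have mH2 : measurable_fun setT (fun x => (frob2 (H x))%:E).
  by apply/measurable_EFinP; exact: measurable_frob2.
have H0 x : (0 <= (frob2 (H x))%:E)%E by rewrite lee_fin frob2_ge0.
have mHZ2 s : 0 <= s -> measurable_fun setT (fun w => (frob2 (H (Z s w)))%:E).
  by move=> s0; apply/measurable_EFinP; apply: measurable_frob2; exact: mHZ.
apply: (@le_lt_trans _ _ (\int[nu]_w (2%:E * (frob2 (H (Z t w)))%:E +
    2%:E * (frob2 (H (Z 0 w)))%:E))%E).
  apply: ge0_le_integralT => w; first by rewrite lee_fin frob2_ge0.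
  by rewrite -!EFinM -EFinD lee_fin frob2D_le.
rewrite ge0_integralD//; last 4 first.
- by move=> w _; rewrite -EFinM lee_fin mulr_ge0 ?frob2_ge0.
- by apply: measurable_funeM; exact: mHZ2.
- by move=> w _; rewrite -EFinM lee_fin mulr_ge0 ?frob2_ge0.
- by apply: measurable_funeM; exact: mHZ2.
rewrite !ge0_integralZl//; do ?exact: mHZ2.
rewrite (stationary_integral Z_markov (F := fun x => (frob2 (H x))%:E))//.
rewrite (stationary_integral Z_markov (F := fun x => (frob2 (H x))%:E))//.
by rewrite lte_add_pinfty// lte_mul_pinfty.
Qed.

Hypothesis hH : forall x, H x \is hermsymmx.

Let hincr t w : incr t w \is hermsymmx.
Proof. exact: hermB. Qed.

Let diag t i w := complex.Re ((incr t w ^+ 2) i i).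

Let diag_ge0 t i w : 0 <= diag t i w.
Proof. by rewrite /diag herm_sq_diag// sumr_ge0// => k _; exact: sqn_ge0. Qed.

Let mdiag t i : 0 <= t -> measurable_fun setT (diag t i).
Proof. by move=> t0; have [] := mx_measurable_sq (mx_measurable_incr t0) i i. Qed.

Let diag_fin t i : 0 <= t -> (\int[nu]_w (diag t i w)%:E < +oo)%E.
Proof.
move=> t0; apply: le_lt_trans (frob_finite_incr t0); apply: ge0_le_integralT => w.
  by rewrite lee_fin.
rewrite lee_fin; apply: le_trans (ler_norm _) _.
by have [] := sq_entry_le (incr t w) i i.
Qed.

Let cond_diagE t i z : complex.Re (cond_sq_incr Z P H t z i i) = \int[P z]_w diag t i w.
Proof. by rewrite mxE. Qed.

Let approx t i z := complex.Re (cdc_approx Z P H t z i i).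

Let approxE t i z : approx t i z = (2 * t)^-1 * \int[P z]_w diag t i w.
Proof. by rewrite /approx mxE cReRM cond_diagE. Qed.

Let cond_int t i : 0 <= t -> mu.-integrable setT (EFin \o (fun z => \int[P z]_w diag t i w)).
Proof.
move=> t0; apply/integrableP; split.
  by apply/measurable_EFinP/measurable_kernel_Rintegral; exact: mdiag.
apply: le_lt_trans (diag_fin i t0).
rewrite -(integral_kernel_Rintegral (diag_ge0 t i) (mdiag i t0) (diag_fin i t0)).
apply: ge0_le_integralT => z //=.
by rewrite lee_fin ger0_norm// Rintegral_ge0.
Qed.

Let approx_int t i : 0 <= t -> mu.-integrable setT (EFin \o approx t i).
Proof.
move=> t0; apply: eq_integrable (integrableZl measurableT (2 * t)^-1 (cond_int i t0)) => //.
by move=> z _; rewrite /= approxE.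
Qed.

(** The trace of the approximation of the Dirichlet form at time [t]. As an
    integral over the paths of a nonnegative function it lives in the extended
    reals, where Fatou's lemma and reversibility apply to it. *)
Definition energy t := ((2 * t)^-1%:E * \int[nu]_w (frob2 (incr t w))%:E)%E.

Let energyE t : 0 <= t -> energy t = (\sum_i \int[mu]_z approx t i z)%:E.
Proof.
move=> t0; rewrite /energy.
have -> : (\int[nu]_w (frob2 (incr t w))%:E = \sum_i \int[nu]_w (diag t i w)%:E)%E.
  rewrite -ge0_integral_sum//; last 2 first.
  - by move=> i; apply/measurable_EFinP; exact: mdiag.
  - by move=> i w _; rewrite lee_fin.
  apply: eq_integral => w _; rewrite sumEFin; congr EFin.
  by rewrite -(herm_rtr_sq (hincr t w)) /mxtrace cRe_sum.
rewrite -sumEFin ge0_sume_distrr; last first.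
  by move=> i _; apply: integral_ge0 => w _; rewrite lee_fin.
apply: eq_bigr => i _.
rewrite -(integral_kernel_Rintegral (diag_ge0 t i) (mdiag i t0) (diag_fin i t0)).
rewrite (Rintegral_EFin (cond_int i t0)) -EFinM -(RintegralZl _ measurableT (cond_int i t0)).
by congr EFin; apply: eq_Rintegral => z _; rewrite approxE.
Qed.

(** The diagonal entries of the approximate carre du champ converge in mean,
    hence so do their integrals; the limit in the definition of [dirichlet] is
    taken entry by entry. *)
Lemma energy_cvg : cdc_exists Z P mu H ->
  energy t @[t --> 0^'+] --> (complex.Re (\tr (dirichlet Z P mu H)))%:E.
Proof.
move=> [cp cL].
have dE t i : complex.Re ((((2 * t)^-1)%:C *: mexp mu (cond_sq_incr Z P H t)) i i) =
    (2 * t)^-1 * \int[mu]_z \int[P z]_w diag t i w.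
  rewrite mxE cReRM mxE /=; congr (_ * _); apply: eq_Rintegral => z _.
  exact: cond_diagE.
pose a i z := complex.Re (cdc Z P H z i i).
have ma i : measurable_fun setT (a i) by have [] := mx_measurable_cdc cp i i.
have mapp t i : 0 <= t -> measurable_fun setT (approx t i).
  by move=> t0; have [] := mx_measurable_cdc_approx t0 i i.
have /fine_cvgP[Lfin Lcvg] := cL.
have ReB (A B : 'M[R[i]]_n) i : complex.Re ((A - B) i i) =
    complex.Re (A i i) - complex.Re (B i i) by rewrite !mxE cReD cReN.
have diffle t i : (\int[mu]_z `|approx t i z - a i z|%:E <=
    \int[mu]_z (opnorm (cdc_approx Z P H t z - cdc Z P H z))%:E)%E.
  apply: ge0_le_integralT => z; first by rewrite lee_fin.
  rewrite lee_fin; have := norm_Re_le_opnorm (cdc_approx Z P H t z - cdc Z P H z) i i.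
  by rewrite ReB.
have ai i : mu.-integrable setT (EFin \o a i).
  have [t [t0 tf]] := filter_ex (filterI (nbhs_right_gt 0) Lfin).
  have appi := approx_int i (ltW t0).
  have di : mu.-integrable setT (EFin \o (fun z => approx t i z - a i z)).
    apply/integrableP; split.
      by apply/measurable_EFinP/measurable_funB => //; exact: mapp (ltW t0).
    by apply: le_lt_trans (diffle t i) _; rewrite ltey_eq tf.
  apply: eq_integrable (integrableB measurableT appi di) => // z _.
  by rewrite /= -EFinB; congr EFin; ring.
have phi_cvg i : \int[mu]_z approx t i z @[t --> 0^'+] --> \int[mu]_z a i z.
  apply/cvgrPdist_lt => e e0.
  move/cvgrPdist_lt : Lcvg => /(_ e e0) Lcvg.
  pose I' t := (\int[mu]_z (opnorm (cdc_approx Z P H t z - cdc Z P H z))%:E)%E.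
  have {}Lfin : \forall t \near 0^'+, I' t \is a fin_num by exact: Lfin.
  have {}Lcvg : \forall t \near 0^'+, `|0 - fine (I' t)| < e by exact: Lcvg.
  near=> t.
  have t0 : 0 < t by near: t; exact: nbhs_right_gt.
  have If : I' t \is a fin_num by near: t; exact: Lfin.
  have Ie : `|0 - fine (I' t)| < e by near: t; exact: Lcvg.
  have appi := approx_int i (ltW t0).
  have di : mu.-integrable setT (EFin \o (fun z => a i z - approx t i z)).
    by apply: eq_integrable (integrableB measurableT (ai i) appi).
  have -> : \int[mu]_z a i z - \int[mu]_z approx t i z =
      \int[mu]_z (a i z - approx t i z) by rewrite RintegralB.
  apply: le_lt_trans (le_normr_Rintegral measurableT di) _.
  have ad0 : (0 <= \int[mu]_z `|a i z - approx t i z|%:E)%E.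
    by apply: integral_ge0 => z _; rewrite lee_fin.
  have le1 : (\int[mu]_z `|a i z - approx t i z|%:E <= I' t)%E.
    by apply: le_trans (diffle t i); under eq_integral do rewrite distrC.
  apply: le_lt_trans Ie; rewrite sub0r normrN ger0_norm; last first.
    by apply: fine_ge0; apply: le_trans le1.
  rewrite /Rintegral fine_le// ge0_fin_numE//.
  by apply: le_lt_trans le1 _; rewrite ltey_eq If.
have limE i : lim (complex.Re ((((2 * t)^-1)%:C *: mexp mu (cond_sq_incr Z P H t)) i i)
    @[t --> 0^'+]) = \int[mu]_z a i z.
  apply/cvg_lim => //; apply: cvg_trans (phi_cvg i); apply: near_eq_cvg.
  near=> t; have t0 : 0 < t by near: t; exact: nbhs_right_gt.
  rewrite dE -(RintegralZl _ measurableT (cond_int i (ltW t0))).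
  by apply: eq_Rintegral => z _; rewrite approxE.
have -> : complex.Re (\tr (dirichlet Z P mu H)) = \sum_i \int[mu]_z a i z.
  rewrite /mxtrace cRe_sum; apply: eq_bigr => i _.
  by rewrite mxE /= limE.
have sum_cvg : (\sum_i \int[mu]_z approx t i z) @[t --> 0^'+] --> \sum_i \int[mu]_z a i z.
  by apply: cvg_big => [|i _]; [exact: add_continuous|exact: phi_cvg].
have esum_cvg : (\sum_i \int[mu]_z approx t i z)%:E @[t --> 0^'+] -->
    (\sum_i \int[mu]_z a i z)%:E.
  by apply/fine_cvgP; split=> //; exact: nearW.
apply: cvg_trans esum_cvg.
apply: near_eq_cvg; near=> t; rewrite energyE//.
Unshelve. all: by end_near.
Qed.

End dirichlet_limit.

(** * The chain rule for the energy *)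

Lemma rtr_sq_mul_sq_ge0 (R : realType) n (X C : 'M[R[i]]_n) :
  X \is hermsymmx -> C \is hermsymmx ->
  0 <= complex.Re (\tr (X ^+ 2 *m C ^+ 2)).
Proof.
move=> /hermP hX /hermP hC.
have -> : \tr (X ^+ 2 *m C ^+ 2) = \tr ((C *m X) *m (C *m X) ^t*).
  rewrite trmx_mul map_mxM hX hC !expr2 -[X * X]/(X *m X) -[C * C]/(C *m C).
  by rewrite !mulmxA mxtrace_mulC !mulmxA.
by rewrite frob2E /= frob2_ge0.
Qed.

Section symmetrization.
Context d dW (T : measurableType d) (W : measurableType dW) {R : realType}.
Variables (Z : R -> W -> T) (P : R.-pker T ~> W) (mu : probability T R).
Hypothesis Z_markov : markov_process Z P.
Hypothesis Z_reversible : reversible Z P mu.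
Local Notation nu := (path_law P mu).

(** Reversibility gives both terms of the upper bound the same mean. *)
Lemma reversible_integral_le t (u : W -> R) (q : T * T -> R) : 0 <= t ->
  (forall w, 0 <= u w) -> (forall p, 0 <= q p) -> measurable_fun setT q ->
  (forall w, u w <= (q (Z t w, Z 0 w) + q (Z 0 w, Z t w)) / 2) ->
  (\int[nu]_w (u w)%:E <= \int[nu]_w (q (Z 0 w, Z t w))%:E)%E.
Proof.
move=> t0 u0 q0 mq uq; have z0 := lexx (0 : R).
have mqZ (s s' : R) : 0 <= s -> 0 <= s' ->
    measurable_fun setT (fun w => (q (Z s w, Z s' w))%:E).
  move=> s0 s'0; apply/measurable_EFinP; apply: (measurableT_comp mq).
  by apply: measurable_fun_pair; exact: (markov_measurable Z_markov).
apply: (@le_trans _ _ (\int[nu]_w ((2^-1)%:E * (q (Z t w, Z 0 w))%:E +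
   (2^-1)%:E * (q (Z 0 w, Z t w))%:E))%E).
  apply: ge0_le_integralT => w; first by rewrite lee_fin.
  by rewrite -!EFinM -EFinD lee_fin -mulrDr mulrC.
rewrite ge0_integralD//; last 4 first.
- by move=> w _; rewrite -EFinM lee_fin mulr_ge0.
- by apply: measurable_funeM; exact: mqZ.
- by move=> w _; rewrite -EFinM lee_fin mulr_ge0.
- by apply: measurable_funeM; exact: mqZ.
rewrite !ge0_integralZl//; do ?[exact: mqZ|by move=> w _; rewrite lee_fin].
rewrite -(reversible_integral Z_markov (F := fun p => (q p)%:E))//; last first.
  exact/measurable_EFinP.
rewrite -ge0_muleDl ?lee_fin// -EFinD.
by rewrite (_ : 2^-1 + 2^-1 = 1 :> R) ?mul1e//; field.
Qed.

End symmetrization.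

Section chain_rule.
Context d dW (T : measurableType d) (W : measurableType dW) {R : realType} {n : nat}.
Variables (Z : R -> W -> T) (P : R.-pker T ~> W) (mu : probability T R).
Hypothesis Z_markov : markov_process Z P.
Hypothesis Z_stationary : stationary Z P mu.
Hypothesis Z_reversible : reversible Z P mu.
Local Notation nu := (path_law P mu).
Variables (f A : T -> 'M[R[i]]_n) (c : R).
Hypothesis hf : forall x, f x \is hermsymmx.
Hypothesis mf : mx_measurable f.
Hypothesis f2 : frob_finite mu f.
Hypothesis hA : forall x, A x \is hermsymmx.
Hypothesis mA : mx_measurable A.
Hypothesis Af : forall x y, A x - A y = c%:C *: (f x - f y).
Let H x := mxfun sinh (A x).
Hypothesis mH : mx_measurable H.

Let S x := mxfun (fun a : R => cosh a ^+ 2) (A x).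

Let mS : mx_measurable S.
Proof.
rewrite (_ : S = fun x => 1%:M + H x *m H x); last first.
  by apply/funext => x; exact: mxfun_cosh2_sinh.
by apply: mx_measurableD; [exact: mx_measurable_cst|exact: mx_measurableM].
Qed.

Let q (p : T * T) : R :=
  complex.Re (\tr ((A p.1 - A p.2) *m (A p.1 - A p.2) *m S p.1)).

Let q_ge0 p : 0 <= q p.
Proof.
rewrite /q rtr_sqB_mxfun//; apply: sumr_ge0 => i _; apply: sumr_ge0 => j _.
by rewrite mulr_ge0 ?overlap_ge0// mulr_ge0// sqr_ge0.
Qed.

Let mq : measurable_fun setT q.
Proof.
have mA1 : mx_measurable (fun p : T * T => A p.1) by exact: (mx_measurable_comp measurable_fst mA).
have mA2 : mx_measurable (fun p : T * T => A p.2) by exact: (mx_measurable_comp measurable_snd mA).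
have mS1 : mx_measurable (fun p : T * T => S p.1) by exact: (mx_measurable_comp measurable_fst mS).
apply: measurable_rtr; apply: mx_measurableM => //.
by apply: mx_measurableM; exact: mx_measurableB.
Qed.

Let qE x y : q (x, y) = c ^+ 2 * complex.Re (\tr ((f y - f x) ^+ 2 *m S x)).
Proof.
have -> : (f y - f x) ^+ 2 = (f x - f y) ^+ 2 by rewrite -[LHS]sqrrN opprB.
rewrite /q /= Af -[(f x - f y) ^+ 2]/((f x - f y) *m (f x - f y)).
rewrite -scalemxAl -scalemxAr -!scalemxAl scalerA mxtraceZ -rmorphM.
by rewrite cReRM.
Qed.

Let mZ t : 0 <= t -> measurable_fun setT (Z t).
Proof. exact: (markov_measurable Z_markov). Qed.

Let mqZ s t : 0 <= s -> 0 <= t -> measurable_fun setT (fun w => (q (Z s w, Z t w))%:E).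
Proof.
move=> s0 t0; apply/measurable_EFinP; apply: (measurableT_comp mq).
by apply: measurable_fun_pair; exact: mZ.
Qed.

Let energy_le_q t : 0 <= t ->
  (\int[nu]_w (frob2 (H (Z t w) - H (Z 0 w)))%:E <=
   \int[nu]_w (q (Z 0 w, Z t w))%:E)%E.
Proof.
move=> t0; apply: (reversible_integral_le Z_markov Z_reversible t0 _ q_ge0 mq).
  by move=> w; exact: frob2_ge0.
move=> w; exact: sinh_trace_chain.
Qed.

Let r t z := complex.Re (\tr (cdc_approx Z P f t z *m mxfun cosh (A z) ^+ 2)).

Let good t z := (\int[P z]_w (frob2 (f (Z t w) - f (Z 0 w)))%:E < +oo)%E.

(** Under [P z] the weight [S (Z 0)] is almost surely the constant [S z], which
    leaves the conditional expectation. *)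
Let rE t z : 0 < t -> good t z ->
  (\int[P z]_w (q (Z 0 w, Z t w))%:E = (c ^+ 2 * (2 * t) * r t z)%:E)%E.
Proof.
move=> t_gt0 gz; have t0 := ltW t_gt0.
have mX : mx_measurable (fun w => f (Z t w) - f (Z 0 w)).
  exact: (mx_measurable_incr Z_markov mf t0).
have [E1 E2] := rtr_mexp_sq_mulr (S z) mX gz.
transitivity (\int[P z]_w (c ^+ 2 * complex.Re (\tr ((f (Z t w) - f (Z 0 w)) ^+ 2 *m S z)))%:E)%E.
  have mG : measurable_fun setT (fun w => (c ^+ 2 *
      complex.Re (\tr ((f (Z t w) - f (Z 0 w)) ^+ 2 *m S z)))%:E).
    have mrt : measurable_fun setT (fun w =>
        complex.Re (\tr ((f (Z t w) - f (Z 0 w)) ^+ 2 *m S z))).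
      apply: measurable_rtr.
      by apply: mx_measurableM; [exact: mx_measurable_sq|exact: mx_measurable_cst].
    apply/measurable_EFinP; apply: measurable_funM; last exact: mrt.
    exact: measurable_cst.
  apply: ae_eq_integral => //; first exact: mqZ.
  have := ae_init Z_markov (measurable_mx_eq (S z) mS) (erefl (S z)).
  by apply: filterS => w /= Sw _; rewrite qE Sw.
under eq_integral do rewrite EFinM.
rewrite integralZl// (Rintegral_EFin (f := fun w =>
  complex.Re (\tr ((f (Z t w) - f (Z 0 w)) ^+ 2 *m S z))) E2).
rewrite -E1 -EFinM; congr EFin.
rewrite /r /cdc_approx -scalemxAl mxtraceZ cReRM mxfun_cosh2 -mulrA; congr (_ * _).
by rewrite mulVKf// mulf_neq0// gt_eqF.
Qed.

Lemma rtr_cdc_approx_cosh2_ge0 t z (B : 'M[R[i]]_n) : 0 < t -> good t z ->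
  0 <= complex.Re (\tr (cdc_approx Z P f t z *m mxfun cosh B ^+ 2)).
Proof.
move=> t_gt0 gz; have t0 := ltW t_gt0.
rewrite /cdc_approx -scalemxAl mxtraceZ cReRM mulr_ge0 ?invr_ge0 ?mulr_ge0//.
have mX : mx_measurable (fun w => f (Z t w) - f (Z 0 w)).
  exact: (mx_measurable_incr Z_markov mf t0).
have [-> _] := rtr_mexp_sq_mulr (mxfun cosh B ^+ 2) mX gz.
apply: Rintegral_ge0 => w _; apply: rtr_sq_mul_sq_ge0; first exact: hermB.
exact: mxfun_herm.
Qed.

(** [sinh_trace_chain] bounds the increment of [H] by weights at both ends of
    the path, and reversibility moves both to the initial state. The positive
    part appears because the conditional second moment of the increment, hence
    the sign of the trace, is under control only for almost every initial
    state. *)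
Lemma energy_chain_rule t : 0 < t ->
  (energy Z P mu H t <= (c ^+ 2)%:E *
    \int[mu]_z (Num.max 0 (complex.Re
      (\tr (cdc_approx Z P f t z *m mxfun cosh (A z) ^+ 2))))%:E)%E.
Proof.
move=> t_gt0; have t0 := ltW t_gt0; have z0 := lexx (0 : R).
have tt0 : 0 < 2 * t by rewrite mulr_gt0.
rewrite /energy; apply: (@le_trans _ _ ((2 * t)^-1%:E *
    \int[nu]_w (q (Z 0 w, Z t w))%:E)%E).
  by rewrite lee_wpmul2l ?energy_le_q// lee_fin invr_ge0 ltW.
have mr : measurable_fun setT (r t).
  apply: measurable_rtr; apply: mx_measurableM.
    exact: mx_measurable_cdc_approx.
  by under eq_fun do rewrite mxfun_cosh2; exact: mS.
have mmax : measurable_fun setT (fun z => (Num.max 0 (r t z))%:E).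
  by apply/measurable_EFinP; apply: measurable_maxr.
have -> : (\int[nu]_w (q (Z 0 w, Z t w))%:E =
    \int[mu]_z ((c ^+ 2 * (2 * t))%:E * (Num.max 0 (r t z))%:E))%E.
  rewrite ge0_integral_path_law//; last 2 first.
  - by move=> w; rewrite lee_fin.
  - exact: mqZ.
  have q0 z : (0 <= \int[P z]_w (q (Z 0 w, Z t w))%:E)%E.
    by apply: integral_ge0 => w _; rewrite lee_fin.
  apply: ge0_ae_eq_integral => //.
  - apply: measurable_kernel_integral; first by move=> w; rewrite lee_fin.
    exact: mqZ.
  - exact: measurable_funeM.
  - move=> z _; rewrite -EFinM lee_fin mulr_ge0 ?le_max ?lexx//.
    by rewrite mulr_ge0 ?sqr_ge0// ltW.
  have : {ae mu, forall z, good t z}.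
    apply: ae_kernel_integral_finite; first by move=> w; exact: frob2_ge0.
      apply: measurable_frob2; exact: (mx_measurable_incr Z_markov mf t0).
    exact: (frob_finite_incr Z_markov Z_stationary mf f2 t0).
  apply: filterS => z gz _; rewrite rE// -EFinM; congr EFin.
  have := q0 z; rewrite rE// lee_fin => pos.
  have [c0|c0] := eqVneq c 0; first by rewrite c0 expr0n !mul0r.
  congr (_ * _); apply/esym/max_idPr.
  by move: pos; rewrite pmulr_rge0// mulr_gt0// exprn_even_gt0.
rewrite ge0_integralZl//; last 2 first.
- by move=> z _; rewrite lee_fin le_max lexx.
- by rewrite lee_fin mulr_ge0 ?sqr_ge0// ltW.
rewrite muleA -EFinM (_ : _ * (c ^+ 2 * _) = c ^+ 2)//.
by rewrite mulrCA mulVf ?mulr1// gt_eqF.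
Qed.

End chain_rule.

(** * The second moment of the hyperbolic sine *)

Lemma cvg_harmonic_right (R : realType) :
  (fun k => k.+1%:R^-1 : R) @ \oo --> (0 : R)^'+.
Proof.
move=> S nS.
have {}nS : nbhs (0 : R) (fun x => 0 < x -> S x) by exact: nS.
have near_S : \forall k \near \oo, 0 < @harmonic R k -> S (harmonic k).
  exact: (@cvg_harmonic R _ nS).
suff : \forall k \near \oo, S (@harmonic R k) by [].
by apply: filterS near_S => k; apply; exact: harmonic_gt0.
Qed.

(** The product of a null set with the whole space is null. *)
Lemma ae_fst d (T : measurableType d) (R : realType) (mu : probability T R)
    (Q : T -> Prop) :
  {ae mu, forall z, Q z} -> {ae (mu \x mu)%E, forall p : T * T, Q p.1}.
Proof.
move=> [N [mN N0 QN]]; exists (N `*` setT); split.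
- exact: measurableX.
- by rewrite product_measure1E// [X in (X * _)%E](_ : _ = 0%E) ?mul0e.
- by move=> p /= Qp; split => //; exact: QN.
Qed.

Section sinh_moment.
Context d dW (T : measurableType d) (W : measurableType dW) {R : realType} {n : nat}.
Variables (Z : R -> W -> T) (P : R.-pker T ~> W) (mu : probability T R).
Hypothesis Z_markov : markov_process Z P.
Hypothesis Z_stationary : stationary Z P mu.
Hypothesis Z_reversible : reversible Z P mu.
Local Notation nu := (path_law P mu).
Variable alpha : R.
Hypothesis alpha_gt0 : 0 < alpha.
Hypothesis poincare : trace_poincare Z P mu alpha.
Variable f : T -> 'M[R[i]]_n.
Hypothesis f_suitable : suitable Z P mu f.
Variable w : R.
Hypothesis w_gt0 : 0 < w.
Hypothesis cdc_le : {ae mu, forall z, opnorm (cdc Z P f z) <= w}.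
Variable c : R.
Hypothesis c_gt0 : 0 < c.

Let g (p : T * T) := f p.1 - f p.2.
Let h (p : T * T) := mxfun sinh (c%:C *: g p).

Let hf x : f x \is hermsymmx.
Proof. by have [[]] := f_suitable. Qed.

Let mf : mx_measurable f.
Proof. by have [[_ /mx_sqintegrable_frob[]]] := f_suitable. Qed.

Let f2 : frob_finite mu f.
Proof. by have [[_ /mx_sqintegrable_frob[]]] := f_suitable. Qed.

Let f_pointwise : cdc_pointwise Z P f.
Proof. by have [[_ _ []]] := f_suitable. Qed.

Let h_regular2 : regular2 Z P mu h.
Proof. by have [_ _ _ /(_ c c_gt0)[]] := f_suitable. Qed.

Let h_exchange : cdc_exchange Z P mu c g.
Proof. by have [_ _ _ /(_ c c_gt0)[]] := f_suitable. Qed.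

Let mh : mx_measurable h.
Proof. by have [/mx_sqintegrable_frob[]] := h_regular2. Qed.

Lemma frob_finite_sinh : frob_finite (mu \x mu)%E h.
Proof. by have [/mx_sqintegrable_frob[]] := h_regular2. Qed.

Let h_regular y : regular Z P mu (fun x => h (x, y)).
Proof. by have [_ /(_ y)] := h_regular2. Qed.

Let mh1 y : mx_measurable (fun x => h (x, y)).
Proof. by have [_ /mx_sqintegrable_frob[]] := h_regular y. Qed.

Let h1 y : frob_finite mu (fun x => h (x, y)).
Proof. by have [_ /mx_sqintegrable_frob[]] := h_regular y. Qed.

Let hh p : h p \is hermsymmx.
Proof. exact: mxfun_herm. Qed.

Let hg p : c%:C *: g p \is hermsymmx.
Proof. by apply: hermZ; exact: hermB. Qed.

Let hC x y : h (y, x) = - h (x, y).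
Proof.
rewrite /h -(mxfun_odd (@sinhN R) (hg (x, y))); congr mxfun.
by rewrite -scalerN /g /= opprB.
Qed.

Let V y := complex.Re (\tr (mvar mu (fun x => h (x, y)))).

Let V_le y : V y <= alpha * complex.Re (\tr (dirichlet Z P mu (fun x => h (x, y)))).
Proof. by have := poincare (h_regular y); rewrite lecE cReRM => /andP[]. Qed.

Let u (k : nat) : R := k.+1%:R^-1.
Let u_gt0 k : 0 < u k. Proof. by rewrite invr_gt0. Qed.

Let D k y := energy Z P mu (fun x => h (x, y)) (u k).

Let D_ge0 k y : (0 <= D k y)%E.
Proof.
rewrite /D /energy mule_ge0//.
  by rewrite lee_fin invr_ge0 mulr_ge0// ltW.
by apply: integral_ge0 => v _; rewrite lee_fin frob2_ge0.
Qed.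

Let mD k : measurable_fun setT (D k).
Proof.
apply: measurable_funeM.
pose F (p : W * T) := (frob2 (h (Z (u k) p.1, p.2) - h (Z 0 p.1, p.2)))%:E.
have mZ s : 0 <= s -> mx_measurable (fun p : W * T => h (Z s p.1, p.2)).
  move=> s0; apply: (mx_measurable_comp (F := h)) => //.
  apply: measurable_fun_pair => //.
  exact: (measurableT_comp (markov_measurable Z_markov s0)).
have mF : measurable_fun setT F.
  apply/measurable_EFinP; apply: measurable_frob2; apply: mx_measurableB; apply: mZ => //.
  exact: ltW.
have F0 p : (0 <= F p)%E by rewrite lee_fin frob2_ge0.
exact: (measurable_fun_fubini_tonelli_G (m1 := nu) F mF F0).
Qed.

Let cdc1_approxE t p : cdc1_approx Z P g t p = cdc_approx Z P f t p.1.
Proof.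
rewrite /cdc1_approx /cdc_approx /cond_sq_incr; congr (_ *: mexp _ _).
by apply/funext => v; rewrite /g /= opprB addrA subrK.
Qed.

Let cdc1E p : cdc1 Z P g p = cdc Z P f p.1.
Proof.
apply: (congr1 (fun F : R -> 'M[R[i]]_n => mx_lim0 F)).
by apply/funext => t; exact: (cdc1_approxE t p).
Qed.

Let S p := mxfun cosh (c%:C *: g p) ^+ 2.

Let mS : mx_measurable S.
Proof.
rewrite (_ : S = fun p => 1%:M + h p *m h p); last first.
  by apply/funext => p; rewrite /S mxfun_cosh2; exact: mxfun_cosh2_sinh.
by apply: mx_measurableD; [exact: mx_measurable_cst|exact: mx_measurableM].
Qed.

Let mcosh2 (M : T -> 'M[R[i]]_n) : mx_measurable M ->
  measurable_fun setT (fun p : T * T => complex.Re (\tr (M p.1 *m S p))).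
Proof.
move=> mM; apply: measurable_rtr; apply: mx_measurableM => //.
exact: (mx_measurable_comp measurable_fst mM).
Qed.

Let E := (\int[mu \x mu]_p (frob2 (h p))%:E)%E.

Let K t p := complex.Re (\tr (cdc_approx Z P f t p.1 *m S p)).

Let intD k : (\int[mu]_y D k y <= (c ^+ 2)%:E *
  \int[mu \x mu]_p (Num.max 0 (K (u k) p))%:E)%E.
Proof.
have mK : measurable_fun setT (fun p => (Num.max 0 (K (u k) p))%:E).
  apply/measurable_EFinP; apply: measurable_maxr => //; apply: mcosh2.
  by apply: mx_measurable_cdc_approx => //; exact: ltW.
rewrite fubini_tonelli2//; last by move=> p; rewrite lee_fin le_max lexx.
rewrite -ge0_integralZl//; last 3 first.
- apply: measurable_fun_fubini_tonelli_G => // p.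
  by rewrite lee_fin le_max lexx.
- by move=> y _; apply: integral_ge0 => z _; rewrite lee_fin le_max lexx.
- by rewrite lee_fin sqr_ge0.
apply: ge0_le_integralT => y //.
have hA x : c%:C *: g (x, y) \is hermsymmx by exact: hg.
have mA : mx_measurable (fun x => c%:C *: g (x, y)).
  apply: mx_measurableZ.
  have mg : mx_measurable (fun x => f x - f y).
    apply: (@mx_measurableB _ T R n f (fun=> f y) mf).
    exact: (@mx_measurable_cst _ T R n (f y)).
  exact: mg.
have Af x x' : c%:C *: g (x, y) - c%:C *: g (x', y) = c%:C *: (f x - f x').
  by rewrite -scalerBr /g /= opprB addrA subrK.
exact: (energy_chain_rule Z_markov Z_stationary Z_reversible mf f2 hA mA Af (mh1 y)
  (u_gt0 k)).
Qed.

Let intK_max k : (\int[mu \x mu]_p (Num.max 0 (K (u k) p))%:E =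
  \int[mu \x mu]_p (K (u k) p)%:E)%E.
Proof.
have uk0 := ltW (u_gt0 k).
have mK : measurable_fun setT (K (u k)).
  by apply: mcosh2; apply: mx_measurable_cdc_approx.
apply: ae_eq_integral => //.
- by apply/measurable_EFinP; apply: measurable_maxr.
- exact/measurable_EFinP.
have goodz : {ae mu, forall z,
    (\int[P z]_v (frob2 (f (Z (u k) v) - f (Z 0 v)))%:E < +oo)%E}.
  apply: ae_kernel_integral_finite; first by move=> v; exact: frob2_ge0.
    by apply: measurable_frob2; exact: (mx_measurable_incr Z_markov mf uk0).
  exact: (frob_finite_incr Z_markov Z_stationary mf f2 uk0).
have := ae_fst goodz; apply: filterS => p gp _; congr EFin; apply/max_idPr.
exact: (rtr_cdc_approx_cosh2_ge0 Z_markov hf mf _ (u_gt0 k) gp).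
Qed.

Let L := (\int[mu \x mu]_p (tr_cosh2 c g (cdc1 Z P g) p)%:E)%E.

Let K_cvg : (\int[mu \x mu]_p (K (u k) p)%:E)%E @[k --> \oo] --> L.
Proof.
have [cv _] := h_exchange.
have := cvg_comp _ _ (@cvg_harmonic_right R) cv; apply: cvg_trans.
apply: near_eq_cvg; apply: nearW => k /=.
by apply: eq_integral => p _; rewrite /tr_cosh2 cdc1_approxE.
Qed.

(** The trace of [Gamma] times [C^2] is at most the norm of [Gamma] times the
    trace of [C^2], and the trace of [cosh (c g)^2] is [n] plus the squared
    norm of [h]. *)
Let L_le : (`|L| <= w%:E * (n%:R%:E + E))%E.
Proof.
have mF : measurable_fun setT (fun p => tr_cosh2 c g (cdc1 Z P g) p).
  rewrite /tr_cosh2; under eq_fun do rewrite cdc1E.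
  by apply: mcosh2; exact: (mx_measurable_cdc Z_markov mf).
have mfr : measurable_fun setT (fun p => (frob2 (h p))%:E).
  by apply/measurable_EFinP; exact: measurable_frob2.
apply: le_trans (le_abse_integral _ _ _) _ => //; first exact/measurable_EFinP.
have -> : (w%:E * (n%:R%:E + E) = \int[mu \x mu]_p (w%:E * (n%:R%:E + (frob2 (h p))%:E)))%E.
  rewrite ge0_integralZl//; last 3 first.
  - exact: emeasurable_funD.
  - by move=> p _; rewrite -EFinD lee_fin addr_ge0 ?frob2_ge0.
  - by rewrite lee_fin ltW.
  rewrite ge0_integralD//; last by move=> p _; rewrite lee_fin frob2_ge0.
  by rewrite (probability_integral_cst (mu \x mu)%E).
apply: ae_ge0_le_integral => //.
- by do 2 apply: measurableT_comp => //.
- move=> p _; rewrite -EFinD -EFinM lee_fin.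
  by apply: mulr_ge0; [exact: ltW|rewrite addr_ge0 ?frob2_ge0].
- by apply: measurable_funeM; exact: emeasurable_funD.
have := ae_fst cdc_le; apply: filterS => p cp _.
rewrite -EFinD -EFinM /= lee_fin /tr_cosh2 cdc1E.
have := rtr_cosh2 (c%:C *: g p); rewrite -mxfun_cosh2 => <-.
have hS := mxfun_herm cosh (c%:C *: g p).
have -> : complex.Re (\tr (mxfun cosh (c%:C *: g p) ^+ 2)) = frob2 (mxfun cosh (c%:C *: g p)).
  exact: herm_rtr_sq.
exact: rtr_mul_sq_le.
Qed.

(** The factor 2 comes from antisymmetry and [alpha] from the Poincare
    inequality in the first coordinate. Fatou's lemma along [t = 1 / (k + 1)]
    exchanges the limit defining the Dirichlet form with the integral in the
    second coordinate, after which the chain rule and the exchange hypothesis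
    bring in the carre du champ of [f]. *)
Lemma sinh_moment_le : (E <= (2 * alpha * c ^+ 2 * w)%:E * (n%:R%:E + E))%E.
Proof.
have a0 := ltW alpha_gt0.
apply: le_trans (antisym_matrix_variance mh hh hC h1 frob_finite_sinh) _.
suff VL : (\int[mu]_y (V y)%:E <= alpha%:E * ((c ^+ 2)%:E * L))%E.
  apply: (@le_trans _ _ (2%:E * (alpha%:E * ((c ^+ 2)%:E * (w%:E * (n%:R%:E + E)))))%E).
    rewrite lee_wpmul2l//; apply: le_trans VL _.
    rewrite lee_wpmul2l ?lee_fin// lee_wpmul2l ?lee_fin ?sqr_ge0//.
    exact: le_trans (lee_abs _) L_le.
  by rewrite !muleA -!EFinM.
have D_cvg y : (alpha%:E * D k y)%E @[k --> \oo] -->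
    (alpha%:E * (complex.Re (\tr (dirichlet Z P mu (fun x => h (x, y)))))%:E)%E.
  apply: cvgeZl => //; have [_ _ hcdc _] := h_regular y.
  have := energy_cvg Z_markov Z_stationary (mh1 y) (h1 y) (fun x => hh (x, y)) hcdc.
  by move=> /(cvg_comp _ _ (@cvg_harmonic_right R)).
apply: (@le_trans _ _ (\int[mu]_y limn_einf (fun k => alpha%:E * D k y))%E).
  apply: ge0_le_integralT => y; first by rewrite lee_fin rtr_mvar_section_ge0.
  have [-> _] := cvg_limn_einf_sup (D_cvg y).
  by rewrite -EFinM lee_fin V_le.
apply: (le_trans (fatou mu measurableT _ _)).
- by move=> k; apply: measurable_funeM.
- by move=> k y _; rewrite mule_ge0 ?lee_fin.
have B_cvg : (alpha%:E * ((c ^+ 2)%:E * \int[mu \x mu]_p (K (u k) p)%:E))%E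
    @[k --> \oo] --> (alpha%:E * ((c ^+ 2)%:E * L))%E.
  by apply: cvgeZl => //; apply: cvgeZl => //; exact: K_cvg.
rewrite limn_einf_lim -(cvg_lim _ B_cvg)//; apply: lee_lim.
- exact: is_cvg_einfs.
- by apply/cvg_ex; eexists; exact: B_cvg.
apply: nearW => k; apply: (@le_trans _ _ (\int[mu]_y (alpha%:E * D k y))%E).
  by apply: ereal_inf_lbound; exists k => //=.
rewrite ge0_integralZl//.
by rewrite lee_wpmul2l ?lee_fin// -intK_max intD.
Qed.

End sinh_moment.

(** * Concentration *)

Lemma le_opnormZ (R : realType) n (c : R) (M : 'M[R[i]]_n) : 0 < c ->
  c * opnorm M <= opnorm (c%:C *: M).
Proof.
move=> c0; rewrite mulrC -ler_pdivlMr//; apply: opnorm_le => [|v].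
  by rewrite divr_ge0 ?opnorm_ge0// ltW.
rewrite mulrAC ler_pdivlMr// mulrC -l2normZ ?(ltW c0)//.
by rewrite scalemxAl; exact: l2norm_mulmx.
Qed.

Section jensen.
Context d (T : measurableType d) {R : realType} {n : nat}.
Variable mu : probability T R.
Variable f : T -> 'M[R[i]]_n.
Hypothesis hf : forall x, f x \is hermsymmx.
Hypothesis mf : mx_measurable f.
Hypothesis f2 : frob_finite mu f.

Let entry_int (k : T -> R) : measurable_fun setT k ->
  (\int[mu]_x (k x ^+ 2)%:E < +oo)%E -> mu.-integrable setT (EFin \o k).
Proof. by move=> mk k2; apply: integrable_of_sq => //; exact: probability_setT. Qed.

Lemma rtr_centered (S : 'M[R[i]]_n) (c : R) (F := fun x => c%:C *: (mexp mu f - f x)) :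
  mu.-integrable setT (fun x => (complex.Re (\tr (F x *m S)))%:E) /\
  \int[mu]_x complex.Re (\tr (F x *m S)) = 0.
Proof.
have reI i j : mu.-integrable setT (EFin \o (fun x => complex.Re (f x i j))).
  by apply: entry_int; [have [] := mf i j|exact: frob_finite_Re].
have imI i j : mu.-integrable setT (EFin \o (fun x => complex.Im (f x i j))).
  by apply: entry_int; [have [] := mf i j|exact: frob_finite_Im].
have cst (a : R) : mu.-integrable setT (EFin \o (fun _ : T => a)).
  exact: finite_measure_integrable_cst.
have centered (k : T -> R) (a := \int[mu]_x k x) : mu.-integrable setT (EFin \o k) ->
    mu.-integrable setT (EFin \o (fun x => c * (a - k x))) /\
    \int[mu]_x (c * (a - k x)) = 0.
  move=> kI.
  have dI : mu.-integrable setT (EFin \o (fun x => a - k x)).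
    by apply: eq_integrable (integrableB measurableT (cst a) kI).
  split; first by apply: eq_integrable (integrableZl measurableT c dI).
  rewrite RintegralZl// RintegralB//.
  have -> : \int[mu]_x a = a by rewrite /Rintegral probability_integral_cst.
  by rewrite subrr mulr0.
have ReF x i j : complex.Re (F x i j) =
    c * (\int[mu]_y complex.Re (f y i j) - complex.Re (f x i j)).
  by rewrite /F mxE cReRM !mxE cReD cReN.
have ImF x i j : complex.Im (F x i j) =
    c * (\int[mu]_y complex.Im (f y i j) - complex.Im (f x i j)).
  by rewrite /F mxE cImRM !mxE cImD cImN.
have [] := @integrable_rtr_mulr _ _ _ _ mu F S.
- by move=> i j; under eq_fun do rewrite ReF; have [] := centered _ (reI i j).
- by move=> i j; under eq_fun do rewrite ImF; have [] := centered _ (imI i j).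
move=> iF ->; split=> //.
rewrite (_ : mexp mu F = 0) ?mul0mx ?mxtrace0//.
apply/matrixP => i j; rewrite !mxE; apply/eqP; rewrite eq_complex /=.
apply/andP; split; apply/eqP.
- by under eq_Rintegral do rewrite ReF; have [_ ->] := centered _ (reI i j).
- by under eq_Rintegral do rewrite ImF; have [_ ->] := centered _ (imI i j).
Qed.

Hypothesis n_gt0 : (0 < n)%N.
Variable c : R.
Hypothesis c_gt0 : 0 < c.

(** The largest eigenvalue modulus bounds the norm, so the left-hand side is at
    most the trace of [cosh (2 A)] for [A = c (f z - E f)]. As [c (f z - f y)]
    has mean [A] in [y], [cosh_trace_tangent] integrates to the claim. *)
Lemma cosh_opnorm_jensen z :
  measurable_fun setT (fun y => frob2 (mxfun sinh (c%:C *: (f z - f y)))) ->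
  ((cosh (2 * (c * opnorm (f z - mexp mu f))))%:E <=
   \int[mu]_y (n%:R + 2 * frob2 (mxfun sinh (c%:C *: (f z - f y))))%:E)%E.
Proof.
move=> mh; set h := fun y => frob2 _ in mh *; set M := mexp mu f.
have [->|fin] := eqVneq (\int[mu]_y (n%:R + 2 * h y)%:E)%E +oo%E; first exact: leey.
have h0 y : 0 <= n%:R + 2 * h y by rewrite addr_ge0// mulr_ge0// frob2_ge0.
have mh2 : measurable_fun setT (fun y => n%:R + 2 * h y).
  by apply: measurable_funD => //; exact: measurable_funM.
have hI : mu.-integrable setT (EFin \o (fun y => n%:R + 2 * h y)).
  apply/integrableP; split; first exact/measurable_EFinP.
  under eq_integral do rewrite /= ger0_norm//.
  by rewrite ltey.
have hM : M \is hermsymmx by exact: mexp_herm.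
pose A := c%:C *: (f z - M); have hA : A \is hermsymmx by apply: hermZ; exact: hermB.
pose S := mxfun (fun x => 2 * sinh (2 * x)) A.
have [lI l0] := rtr_centered S c.
pose a := complex.Re (\tr (mxfun (fun x => cosh (2 * x)) A)).
have aI : mu.-integrable setT (EFin \o (fun _ : T => a)).
  exact: finite_measure_integrable_cst.
apply: (@le_trans _ _ a%:E).
  rewrite lee_fin; apply: le_trans (cosh_opnorm n_gt0 hA); apply: le_cosh.
    by rewrite !mulr_ge0// ?opnorm_ge0// ltW.
  by rewrite ler_wpM2l// le_opnormZ.
have -> : a%:E = (\int[mu]_y (a + complex.Re (\tr (c%:C *: (M - f y) *m S))))%R%:E.
  rewrite (RintegralD _ aI lI)// l0 addr0.
  by rewrite /Rintegral probability_integral_cst.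
rewrite (Rintegral_EFin hI) lee_fin; apply: le_Rintegral => //.
  by apply: eq_integrable (integrableD measurableT aI lI).
move=> y _; have hB : c%:C *: (f z - f y) \is hermsymmx by apply: hermZ; exact: hermB.
have BA : c%:C *: (f z - f y) - A = c%:C *: (M - f y).
  by rewrite /A -scalerBr opprB [in LHS]addrC addrA subrK.
by have := cosh_trace_tangent hA hB; rewrite BA (mxtrace_mulC S).
Qed.

End jensen.

Section concentration.
Context d dW (T : measurableType d) (W : measurableType dW) {R : realType} {n : nat}.
Variables (Z : R -> W -> T) (P : R.-pker T ~> W) (mu : probability T R).
Hypothesis Z_markov : markov_process Z P.
Hypothesis Z_stationary : stationary Z P mu.
Hypothesis Z_reversible : reversible Z P mu.
Variable alpha : R.
Hypothesis alpha_gt0 : 0 < alpha.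
Hypothesis poincare : trace_poincare Z P mu alpha.
Hypothesis n_gt0 : (0 < n)%N.
Variable f : T -> 'M[R[i]]_n.
Hypothesis f_suitable : suitable Z P mu f.

Let hf x : f x \is hermsymmx.
Proof. by have [[]] := f_suitable. Qed.

Let mf : mx_measurable f.
Proof. by have [[_ /mx_sqintegrable_frob[]]] := f_suitable. Qed.

Let f2 : frob_finite mu f.
Proof. by have [[_ /mx_sqintegrable_frob[]]] := f_suitable. Qed.

Let dev z := opnorm (f z - mexp mu f).

Lemma measurable_deviation_ge (s : R) : 0 <= s -> measurable [set z | s <= dev z].
Proof.
move=> s0; have hM := mexp_herm hf mf f2.
have hd z : f z - mexp mu f \is hermsymmx by exact: hermB.
have md : mx_measurable (fun z => f z - mexp mu f).
  by apply: mx_measurableB => //; exact: mx_measurable_cst.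
have mX k : mx_measurable (fun z => (f z - mexp mu f) ^+ k).
  elim: k => [|k IH].
    by under eq_fun do rewrite expr0; exact: mx_measurable_cst.
  by under eq_fun do rewrite exprS; exact: mx_measurableM.
rewrite (_ : [set z | _] = \bigcap_k [set z | s ^+ (2 * k) <=
    complex.Re (\tr ((f z - mexp mu f) ^+ (2 * k)))]); last first.
  apply/seteqP; split=> z /=.
    by move=> /(ge_opnorm_powerP n_gt0 (hd z) s0) sz k _; exact: sz.
  by move=> sz; apply/(ge_opnorm_powerP n_gt0 (hd z) s0) => k; exact: sz.
apply: bigcap_measurable => // k _.
have mt := measurable_rtr (mX (2 * k)%N).
rewrite -[X in measurable X]setTI.
rewrite (_ : [set z | _] = (fun z => complex.Re (\tr ((f z - mexp mu f) ^+ (2 * k)))) @^-1`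
    `[s ^+ (2 * k), +oo[); first by apply: mt => //; exact: measurable_itv.
by apply/seteqP; split=> z /=; rewrite in_itv /= andbT.
Qed.

Section given_bound.
Variable w : R.
Hypothesis w_gt0 : 0 < w.
Hypothesis cdc_le : {ae mu, forall z, opnorm (cdc Z P f z) <= w}.

Let sigma := Num.sqrt (alpha * w).

Let sigma_gt0 : 0 < sigma.
Proof. by rewrite sqrtr_gt0 mulr_gt0. Qed.

Let c := (2 * sigma)^-1.

Let c_gt0 : 0 < c.
Proof. by rewrite invr_gt0 mulr_gt0. Qed.

Let G z := (\int[mu]_y (n%:R + 2 * frob2 (mxfun sinh (c%:C *: (f z - f y))))%:E)%E.

Let h (p : T * T) := mxfun sinh (c%:C *: (f p.1 - f p.2)).

Let mh : measurable_fun setT (fun p => frob2 (h p)).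
Proof.
have [_ _ _ /(_ c c_gt0)[[/mx_sqintegrable_frob[mh _] _ _ _ _] _]] := f_suitable.
exact: measurable_frob2.
Qed.

Let mh2 : measurable_fun setT (fun p => (n%:R + 2 * frob2 (h p))%:E).
Proof. by apply/measurable_EFinP/measurable_funD => //; exact: measurable_funM. Qed.

Let h0 p : (0 <= (n%:R + 2 * frob2 (h p))%:E)%E.
Proof. by rewrite lee_fin addr_ge0// mulr_ge0// frob2_ge0. Qed.

Let mG : measurable_fun setT G.
Proof. exact: (measurable_fun_fubini_tonelli_F (m2 := mu) _ mh2 h0). Qed.

Let G_ge0 z : (0 <= G z)%E.
Proof. by apply: integral_ge0 => y _; exact: (h0 (z, y)). Qed.

Let cosh_le z : ((cosh (dev z / sigma))%:E <= G z)%E.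
Proof.
have mhz : measurable_fun setT (fun y => frob2 (mxfun sinh (c%:C *: (f z - f y)))).
  exact: (measurableT_comp mh (measurable_fun_pair (measurable_cst z) (@measurable_id _ _ setT))).
have := cosh_opnorm_jensen hf mf f2 n_gt0 c_gt0 mhz.
rewrite (_ : 2 * (c * opnorm (f z - mexp mu f)) = dev z / sigma)//.
by rewrite /c /dev; field; rewrite gt_eqF.
Qed.

Let intG : (\int[mu]_z G z <= (3 * n%:R)%:E)%E.
Proof.
have frob_h : (\int[mu \x mu]_p (frob2 (h p))%:E <= n%:R%:E)%E.
  have := sinh_moment_le Z_markov Z_stationary Z_reversible alpha_gt0 poincare
    f_suitable w_gt0 cdc_le c_gt0.
  have := frob_finite_sinh f_suitable c_gt0; rewrite /frob_finite.
  have : (0 <= \int[mu \x mu]_p (frob2 (h p))%:E)%E.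
    by apply: integral_ge0 => p _; rewrite lee_fin frob2_ge0.
  rewrite -/h; case: (\int[mu \x mu]_p (frob2 (h p))%:E)%E => [e||]//.
  move=> _ _; rewrite -EFinD -EFinM !lee_fin.
  (* This is the choice of [c]: a finite [e <= (n + e) / 2] is at most [n]. *)
  have -> : 2 * alpha * c ^+ 2 * w = 2^-1.
    have s2 : alpha * w = sigma ^+ 2 by rewrite sqr_sqrtr// mulr_ge0// ltW.
    have -> : 2 * alpha * c ^+ 2 * w = 2 * c ^+ 2 * (alpha * w) by ring.
    by rewrite s2 /c; field; rewrite gt_eqF.
  by move=> ?; lra.
have -> : (\int[mu]_z G z = \int[mu \x mu]_p (n%:R + 2 * frob2 (h p))%:E)%E.
  by rewrite (fubini_tonelli1 _ mh2 h0).
have -> : (\int[mu \x mu]_p (n%:R + 2 * frob2 (h p))%:E =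
    n%:R%:E + 2%:E * \int[mu \x mu]_p (frob2 (h p))%:E)%E.
  under eq_integral do rewrite EFinD EFinM.
  have mfh : measurable_fun setT (fun p => (frob2 (h p))%:E) by exact/measurable_EFinP.
  rewrite ge0_integralD//; last 2 first.
  - by move=> p _; rewrite -EFinM lee_fin mulr_ge0// frob2_ge0.
  - exact: measurable_funeM.
  rewrite (probability_integral_cst (mu \x mu)%E) ge0_integralZl//.
  by move=> p _; rewrite lee_fin frob2_ge0.
apply: (@le_trans _ _ (n%:R%:E + 2%:E * n%:R%:E)%E).
  by rewrite leeD2l// lee_wpmul2l.
by rewrite -EFinM -EFinD lee_fin; lra.
Qed.

(** Markov's inequality for [cosh (dev z / sigma)], whose mean is at most
    [3 n], with [exp x <= 2 cosh x]. *)
Lemma deviation_tail (lambda : R) : 0 < lambda ->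
  (mu [set z | (sigma * lambda)%:E <= (dev z)%:E] <=
   (6 * n%:R * expR (- lambda))%:E)%E.
Proof.
move=> l0; set X := [set z | _].
have mX : measurable X.
  rewrite (_ : X = [set z | sigma * lambda <= dev z]).
    by apply: measurable_deviation_ge; rewrite mulr_ge0// ltW.
  by apply/seteqP; split=> z; rewrite /X /= lee_fin.
have cl : 0 < cosh lambda.
  by rewrite /cosh divr_gt0// addr_gt0// expR_gt0.
have : ((cosh lambda)%:E * mu X <= (3 * n%:R)%:E)%E.
  apply: le_trans intG; rewrite -[X in mu X]setIT -integral_indic//.
  rewrite -ge0_integralZl//; last 2 first.
  - exact/measurable_EFinP.
  - by rewrite lee_fin ltW.
  apply: ge0_le_integralT => z; first by rewrite mule_ge0// lee_fin// ltW.
  rewrite indicE; case: (boolP (z \in X)) => zX; last by rewrite mule0.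
  rewrite mule1; apply: le_trans (cosh_le z); rewrite lee_fin le_cosh ?(ltW l0)//.
  by rewrite ler_pdivlMr// mulrC; move: zX; rewrite inE /X /= lee_fin.
rewrite -lee_pdivlMl// => /le_trans; apply; rewrite -EFinM lee_fin.
rewrite ler_pdivrMl//.
have ee : expR (- lambda) * expR lambda = 1 by rewrite -expRD addNr expR0.
have ce : 1 <= 2 * cosh lambda * expR (- lambda).
  by rewrite -[leLHS]ee mulrC ler_wpM2r ?expR_ge0 ?expR_le_cosh.
have n0 := ler0n R n.
rewrite (_ : cosh lambda * _ = 3 * n%:R * (2 * cosh lambda * expR (- lambda))); last by ring.
by rewrite ler_peMr// mulr_ge0.
Qed.

(** [dev z / sigma] is bounded with the tangent line of the exponential at
    [ln k], where [k = 6 e n]; the exponential moment is at most [6 n = k / e],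
    so that the last term contributes at most 1. *)
Lemma deviation_mean :
  (\int[mu]_z (dev z)%:E <= (ln (6 * expR 1 * n%:R) * sigma)%:E)%E.
Proof.
set k := 6 * expR 1 * n%:R.
have n1 : 1 <= n%:R :> R by rewrite ler1n.
have e1 : 0 < expR 1 :> R := expR_gt0 _.
have ke : expR 1 <= k.
  rewrite /k mulrAC ler_peMl ?ltW//; lra.
have k0 : 0 < k by exact: lt_le_trans e1 ke.
have lnk : 1 <= ln k by rewrite -[X in X <= _](expRK 1) ler_ln ?posrE.
have tangent (x : R) : x <= ln k - 1 + 2 * cosh x / k.
  have := expR_ge1Dx (x - ln k); rewrite expRD expRN lnK ?posrE// => H.
  have : expR x / k <= 2 * cosh x / k by rewrite ler_wpM2r ?invr_ge0 ?expR_le_cosh// ltW.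
  lra.
have s0 := ltW sigma_gt0.
have a0 : 0 <= sigma * (ln k - 1) by rewrite mulr_ge0// subr_ge0.
have b0 : 0 <= sigma * 2 / k by rewrite divr_ge0 ?mulr_ge0// ltW.
apply: (@le_trans _ _ (\int[mu]_z ((sigma * (ln k - 1))%:E + (sigma * 2 / k)%:E * G z))%E).
  apply: ge0_le_integralT => z; first by rewrite lee_fin opnorm_ge0.
  apply: (@le_trans _ _ ((sigma * (ln k - 1))%:E +
      (sigma * 2 / k)%:E * (cosh (dev z / sigma))%:E)%E).
    rewrite -EFinM -EFinD lee_fin.
    have := tangent (dev z / sigma); rewrite ler_pdivrMr// => /le_trans; apply.
    rewrite le_eqVlt; apply/orP; left; apply/eqP; field; exact: lt0r_neq0.
  by rewrite leeD2l// lee_wpmul2l ?lee_fin.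
rewrite ge0_integralD//; last 2 first.
- by move=> z _; rewrite mule_ge0 ?lee_fin.
- exact: measurable_funeM.
rewrite probability_integral_cst ge0_integralZl//.
apply: (@le_trans _ _ ((sigma * (ln k - 1))%:E + (sigma * 2 / k)%:E * (3 * n%:R)%:E)%E).
  by rewrite leeD2l// lee_wpmul2l ?lee_fin.
rewrite -EFinM -EFinD lee_fin.
have : sigma * 2 / k * (3 * n%:R) <= sigma.
  rewrite mulrAC ler_pdivrMr// -!mulrA ler_wpM2l//.
  have := expR_ge1Dx (1 : R); rewrite /k; nra.
lra.
Qed.

End given_bound.
End concentration.

(** * The theorem *)

Local Close Scope complex_scope.
Local Close Scope sesquilinear_scope.

Theorem theorem2p7 (R : realType)
    (Omega : ptopologicalType) (Omega_polish : polish R Omega)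
    (dW : measure_display) (W : measurableType dW)
    (Z : R -> W -> Borel Omega) (P : R.-pker (Borel Omega) ~> W)
    (mu : probability (Borel Omega) R)
    (Z_markov : markov_process Z P)
    (mu_stationary : stationary Z P mu)
    (mu_reversible : reversible Z P mu)
    (alpha : R) (alpha_gt0 : 0 < alpha)
    (poincare : trace_poincare Z P mu alpha)
    (d : nat) (d_gt0 : (0 < d)%N)
    (f : Borel Omega -> 'M[R[i]]_d) (f_suitable : suitable Z P mu f) :
  let v := variance_proxy Z P mu f in
  (* If v = 0 the event below is the whole space, so the bound needs v > 0. *)
  (0 < v ->
   forall lambda : R, (0 < lambda)%R ->
     mu [set z | sqrte (alpha%:E * v) * lambda%:E
                   <= (opnorm (f z - mexp mu f)%R)%:E]
       <= (6 * d%:R * expR (- lambda))%:E)%E /\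
  (\int[mu]_z (opnorm (f z - mexp mu f)%R)%:E
     <= (ln (6 * expR 1 * d%:R))%:E * sqrte (alpha%:E * v))%E.

Proof.
move=> v.
have v0 : (0 <= v)%E by exact: Lnorm_ge0.
have cdc_v : {ae mu, forall z, ((opnorm (cdc Z P f z))%:E <= v)%E}.
  rewrite /v /variance_proxy unlock /=.
  rewrite (_ : (0 < mu setT)%E = true); last first.
    rewrite [X in (0 < X)%E](_ : _ = 1%E); first exact: lte01.
    exact: (@probability_setT _ _ _ mu).
  apply: filterS (ess_sup_ge mu _) => z; apply: le_trans.
  by rewrite /= lee_fin ler_norm.
have n1 : 1 <= d%:R :> R by rewrite ler1n.
have k1 : 1 < 6 * expR 1 * d%:R :> R.
  have := expR_ge1Dx (1 : R) => e2; nra.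
have lnk0 : 0 < ln (6 * expR 1 * d%:R) :> R by rewrite ln_gt0.
have cdc_w (w : R) : (v <= w%:E)%E -> {ae mu, forall z, opnorm (cdc Z P f z) <= w}.
  by move=> vw; apply: filterS cdc_v => z zv; rewrite -lee_fin (le_trans zv).
have mean (w : R) : 0 < w -> (v <= w%:E)%E ->
    (\int[mu]_z (opnorm (f z - mexp mu f)%R)%:E
     <= (ln (6 * expR 1 * d%:R) * Num.sqrt (alpha * w))%:E)%E.
  move=> w0 /cdc_w vw.
  exact: (deviation_mean Z_markov mu_stationary mu_reversible alpha_gt0 poincare
    d_gt0 f_suitable w0 vw).
split.
  move=> v_gt0 lambda l0.
  case: v => [w||] in v0 cdc_v v_gt0 cdc_w mean *; last by [].
    have w0 : 0 < w by rewrite -lte_fin.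
    exact: (deviation_tail Z_markov mu_stationary mu_reversible alpha_gt0 poincare
      d_gt0 f_suitable w0 (cdc_w w (lexx _)) l0).
  rewrite gt0_muley ?lte_fin//= gt0_mulye ?lte_fin//.
  rewrite (_ : [set z | _] = set0) ?measure0 ?lee_fin ?mulr_ge0 ?expR_ge0//.
  by apply/seteqP; split=> z //=; rewrite leye_eq.
case: v => [w||] in v0 cdc_v cdc_w mean *; last by [].
  have [w0|w0|w0] := ltgtP 0 w; last 2 first.
  - by move: v0; rewrite lee_fin leNgt w0.
  - rewrite -w0 mule0 sqrte0 mule0; apply/lee_addgt0Pr => e e0; rewrite add0e.
    (* The bound [s ^ 2 / alpha] on the variance proxy yields [k * s = e]. *)
    pose k : R := ln (6 * expR 1 * d%:R).
    pose s := e / k.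
    have s0 : 0 < s by rewrite divr_gt0.
    have u0 : 0 < s ^+ 2 / alpha by rewrite divr_gt0// exprn_gt0.
    apply: le_trans (mean _ u0 _) _; first by rewrite lee_fin -w0 ltW.
    rewrite mulrCA mulfV ?gt_eqF// mulr1 sqrtr_sqr ger0_norm ?(ltW s0)//.
    by rewrite lee_fin /s mulrC divfK// gt_eqF.
  by apply: le_trans (mean _ w0 (lexx _)) _; rewrite /= EFinM.
by rewrite gt0_muley ?lte_fin//= gt0_muley ?lte_fin// leey.
Qed.
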